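(* Let $f(\theta)=\cos(\theta+\Theta_0)+f_0$ with $f_0\in(0,1)$ and $\Theta_0\in(0,\pi)$ the unique number such that $f(0)=0$. Let $\ell>0$, $j\in\mathbb{N}$, and let $\theta(x,t)$ be the solution of $$\theta_t=\theta_{xx}+f(\theta)\ (-\ell\le x\le\ell,\ t>0),\qquad \theta(x,0)=\theta_0(x),$$ $$\theta(-\ell,t)=\theta(\ell,t)+2\pi j,\qquad \theta_x(-\ell,t)=\theta_x(\ell,t),$$ with continuous initial datum satisfying $0\le\theta_0\le2\pi j$, $\theta_0(\ell)=0$, $\theta_0(-\ell)=2\pi j$. Let $\hat u$ be the unique solution of $$u''+au'+f(u)=0\ \text{ on }(-\ell,\ell),\quad u(-\ell)=2\pi j,\quad u(\ell)=0,\quad0\le u\le2\pi j,$$ for $a=a(\ell,j)$. Then the $\omega$-limit set of $\theta_0$ consists of the orbit associated to $\hat u$, i.e. of the (time periodic modulo $2\pi$) orbit of the travelling wave solution $(x,t)\mapsto\hat u(x-a(\ell,j)t)$.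
   Context: For each $(\ell,j,a)$ the displayed boundary value problem for $u$ has a unique solution, and $a(\ell,j)$ denotes the unique value of $a$ for which this solution additionally satisfies $u'(-\ell)=u'(\ell)$. The function $\hat u$ is extended to $\mathbb{R}$ by $\hat u(x+2\ell)=\hat u(x)-2\pi j$. Values are identified modulo $2\pi$ (phase dynamics in $S^1=\mathbb{R}/2\pi\mathbb{Z}$): the $\omega$-limit set of $\theta_0$ is the set of accumulation points, as $t\to\infty$, of $\theta(\cdot,t)$ modulo $2\pi$ in the uniform topology on $[-\ell,\ell]$. Here $\mathbb{N}=\{1,2,\dots\}$. *)

(* Defs.v *)
From HB Require Import structures.
From mathcomp Require Import all_boot all_order all_algebra.
From mathcomp Require Import generic_quotient ring.
From mathcomp Require Import all_classical all_reals all_analysis.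

Set Implicit Arguments.
Unset Strict Implicit.
Unset Printing Implicit Defensive.
Import Order.TTheory GRing.Theory Num.Theory.
Import numFieldNormedType.Exports.
Local Open Scope classical_set_scope.
Local Open Scope quotient_scope.
Local Open Scope ring_scope.

Definition mod2pi (R : realType) : rel R :=
  fun x y => `[< exists k : int, x - y = 2 * pi * k%:~R >].

Lemma mod2pi_equiv (R : realType) : equiv_class_of (@mod2pi R).
Proof.
split=> [x|x y|y x z].
- by apply/asboolP; exists 0; rewrite subrr mulr0.
- apply/asbool_equiv_eq; split=> -[k xyk]; exists (- k);
  by rewrite -opprB xyk intrN mulrN.
- move=> /asboolP[k xyk] /asboolP[m yzm]; apply/asboolP; exists (k + m).
  by rewrite intrD mulrDr -xyk -yzm addrA subrK.
Qed.

Canonical mod2pi_equiv_rel (R : realType) := EquivRelPack (@mod2pi_equiv R).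

Definition circle (R : realType) := {eq_quot @mod2pi R}.

Definition to_circle (R : realType) (x : R) : circle R := \pi_(circle R) x.

(* The quotient metric: z and w have representatives at distance less than e. *)
Definition circle_ball (R : realType) (z : circle R) (e : R) (w : circle R) :=
  exists x y : R, [/\ to_circle x = z, to_circle y = w & `|x - y| < e].

Lemma to_circleP (R : realType) (x y : R) :
  to_circle x = to_circle y <-> exists k : int, x - y = 2 * pi * k%:~R.
Proof.
split=> [/eqP|xy]; first by rewrite eqquotE => /asboolP.
by apply/eqP; rewrite eqquotE; apply/asboolP.
Qed.

Lemma circle_ball_center (R : realType) (z : circle R) (e : R) :
  0 < e -> circle_ball z e z.
Proof.
by move=> e0; exists (repr z), (repr z); rewrite /to_circle reprK subrr normr0.
Qed.

Lemma circle_ball_sym (R : realType) (z w : circle R) (e : R) :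
  circle_ball z e w -> circle_ball w e z.
Proof. by move=> [x [y [xz yw xy]]]; exists y, x; rewrite distrC. Qed.

Lemma circle_ball_triangle (R : realType) (z1 z2 z3 : circle R) (e1 e2 : R) :
  circle_ball z1 e1 z2 -> circle_ball z2 e2 z3 -> circle_ball z1 (e1 + e2) z3.
Proof.
move=> [x [y [xz yz xy]]] [y' [w [y'z wz y'w]]].
have /to_circleP[k yy'k] : to_circle y = to_circle y' by rewrite yz y'z.
exists x, (w + (y - y')); split=> //.
  rewrite -wz; apply/to_circleP; exists k.
  by rewrite yy'k addrAC subrr add0r.
have -> : x - (w + (y - y')) = (x - y) + (y' - w) by ring.
exact: le_lt_trans (ler_normD _ _) (ltrD xy y'w).
Qed.

HB.instance Definition _ (R : realType) := Choice.on (circle R).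
HB.instance Definition _ (R : realType) :=
  hasNbhs.Build (circle R) (nbhs_ (entourage_ (@circle_ball R))).
HB.instance Definition _ (R : realType) :=
  @Nbhs_isPseudoMetric.Build R (circle R) (entourage_ (@circle_ball R)) erefl
    (@circle_ball R) (@circle_ball_center R) (@circle_ball_sym R)
    (@circle_ball_triangle R) erefl.

(* Difference quotients are only taken inside A, so that this is the one-sided
   derivative at an endpoint when A is an interval. *)
Definition is_derive_within (R : realType) (A : set R) (g : R -> R) (x d : R) :=
  (g y - g x) / (y - x) @[y --> within A x^'] --> d.

Definition phase_f (R : realType) (Theta0 f0 v : R) : R := cos (v + Theta0) + f0.

(* th has first argument the position x and second argument the time t; thx,
   thxx and tht are its partial derivatives on the closed interval. *)
Record phase_solution_with (R : realType) (f : R -> R) (l : R) (j : nat)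
    (th thx thxx tht : R -> R -> R) : Prop := {
  phase_cont : {within `[- l, l] `*` `[0, +oo[,
    continuous (fun z : R * R => th z.1 z.2)} ;
  phase_contx : {within `[- l, l] `*` `]0, +oo[,
    continuous (fun z : R * R => thx z.1 z.2)} ;
  phase_contxx : {within `[- l, l] `*` `]0, +oo[,
    continuous (fun z : R * R => thxx z.1 z.2)} ;
  phase_contt : {within `[- l, l] `*` `]0, +oo[,
    continuous (fun z : R * R => tht z.1 z.2)} ;
  phase_dx : forall x t : R, x \in `[- l, l] -> 0 < t ->
    is_derive_within `[- l, l] (th^~ t) x (thx x t) ;
  phase_dxx : forall x t : R, x \in `[- l, l] -> 0 < t ->
    is_derive_within `[- l, l] (thx^~ t) x (thxx x t) ;
  phase_dt : forall x t : R, x \in `[- l, l] -> 0 < t ->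
    is_derive t (1 : R) (th x) (tht x t) ;
  phase_eq : forall x t : R, x \in `[- l, l] -> 0 < t ->
    tht x t = thxx x t + f (th x t) ;
  phase_bc : forall t : R, 0 < t -> th (- l) t = th l t + 2 * pi * j%:R ;
  phase_bcx : forall t : R, 0 < t -> thx (- l) t = thx l t }.

Definition phase_solution (R : realType) (f : R -> R) (l : R) (j : nat)
    (th : R -> R -> R) : Prop :=
  exists thx thxx tht : R -> R -> R,
    phase_solution_with f l j th thx thxx tht.

Record bvp_solution (R : realType) (f : R -> R) (l : R) (j : nat) (a : R)
    (u : R -> R) : Prop := {
  bvp_cont : {within `[- l, l], continuous u} ;
  bvp_derivable : forall x : R, x \in `]- l, l[ -> derivable u x 1 ;
  bvp_derivable2 : forall x : R, x \in `]- l, l[ -> derivable (derive1 u) x 1 ;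
  bvp_eq : forall x : R, x \in `]- l, l[ ->
    derive1 (derive1 u) x + a * derive1 u x + f (u x) = 0 ;
  bvp_left : u (- l) = 2 * pi * j%:R ;
  bvp_right : u l = 0 ;
  bvp_range : forall x : R, x \in `[- l, l] -> 0 <= u x <= 2 * pi * j%:R }.

(* u'(-l) = u'(l), with one-sided derivatives. For given f, l and j this is the
   condition that selects the speed a(l, j) among the solutions (a, u) of
   bvp_solution. *)
Definition equal_end_slopes (R : realType) (l : R) (u : R -> R) : Prop :=
  exists d, is_derive_within `[- l, l] u (- l) d /\
            is_derive_within `[- l, l] u l d.

(* Elements of {uniform` [- l, l] -> circle R} are functions on the whole line;
   the topology ignores their values outside [- l, l]. *)
Definition omega_limit (R : realType) (l : R) (th : R -> R -> R) :
    set (R -> circle R) :=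
  cluster ((fun t x => to_circle (th x t)) @ +oo%R
           : set_system {uniform` `[- l, l] -> circle R}).

Definition wave_orbit (R : realType) (l : R) (U : R -> R -> R) :
    set (R -> circle R) :=
  [set v | exists t : R, forall x : R, x \in `[- l, l] -> v x = to_circle (U x t)].

(* Main.v *)
Require Import Defs.
From HB Require Import structures.
From mathcomp Require Import all_boot all_order all_algebra.
From mathcomp Require Import all_classical all_reals all_analysis.
From mathcomp Require Import ring lra.
Import Order.TTheory GRing.Theory Num.Theory.
Import numFieldNormedType.Exports.
Local Open Scope classical_set_scope.
Local Open Scope ring_scope.

(** Unrolled from the circle, the solution and all translates
    [u (x - a * t - s)] of the travelling wave solve the same equation on the
    line and lose [2 * pi * j] over each period, so their differences [w] are
    periodic and satisfy [`|w_t - w_xx| <= `|w|]. Everything rests on two facts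
    about such [w].

    Positivity propagates ([heat_pos]), and a positive [w] eventually satisfies
    [w y t <= C * w x t] for all [x] and [y], with a constant [C] that depends on
    the period only ([heat_harnack]). For the second fact, [q = ln w] solves
    [q_t = q_xx + q_x ^+ 2 + b] with [`|b| <= 1]; one compares
    [q (x + s) t - q x t] with a concave function of [s] by the maximum principle
    in the pair [(x, s)]. At a contact the slopes at the two points agree, so
    the quadratic terms cancel, and the concavity of the barrier absorbs [b].

    Sliding the wave against itself with this inequality shows that [u] is
    strictly decreasing ([wave_decreasing]), so that its translates are ordered
    by the shift. Let [s0] be the infimum of the shifts whose wave lies above the
    solution at some time, hence forever after. For [s] slightly above [s0] the
    difference between wave and solution is positive and its minimum is small,
    of the order of [s - s0]; by the Harnack inequality its maximum eventually is
    small too. As [C] does not depend on [s], the solution converges uniformly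
    to [u (x - a * t - s0)] ([flow_converges]).

    The energy [u' ^+ 2 / 2 + F u], with [F] a primitive of [f], drops over a
    period because the mean of [f] is [f0 > 0], while its derivative is
    [- a * u' ^+ 2]; hence [0 < a] ([wave_speed_gt0]). The wave therefore runs
    through all phases, is periodic modulo [2 * pi], and its orbit is exactly the
    set of accumulation points ([omega_limit_wave]).

    The passage to the line needs [u] and the solution to be smooth across the
    endpoints: the equation transfers the matching of values and slopes there
    to the second derivatives ([bvp_smooth], [unroll_flow]). *)

Set Implicit Arguments.
Unset Strict Implicit.
Unset Printing Implicit Defensive.

(** * Derivatives and continuity on the real line *)

(** Multiplying out the difference quotient lets derivatives be glued, shifted
    and restricted, and makes [y = x] harmless. *)
Lemma is_derive_withinP (R : realType) (A : set R) (g : R -> R) (x d : R) :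
  is_derive_within A g x d <->
  forall e, 0 < e -> exists2 r, 0 < r & forall y, A y -> `|y - x| < r ->
    `|g y - g x - d * (y - x)| <= e * `|y - x|.
Proof.
rewrite /is_derive_within; split.
  move=> /cvgrPdist_le h e e0; have := h e e0.
  move=> [r /= r0 H]; exists r => // y Ay yr.
  have [->|yx] := eqVneq y x; first by rewrite !subrr mulr0 subr0 normr0 mulr0.
  have := H y; rewrite /ball_/= distrC => /(_ yr yx Ay).
  have n0 : 0 < `|y - x| by rewrite normr_gt0 subr_eq0.
  have -> : g y - g x - d * (y - x) = - (d - (g y - g x) / (y - x)) * (y - x).
    by field; rewrite subr_eq0.
  by rewrite normrM normrN ler_pM2r.
move=> H; apply/cvgrPdist_le => e e0; have [r r0 Hr] := H e e0.
exists r => //= y; rewrite /ball_ /= distrC => yr yx Ay.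
have n0 : 0 < `|y - x| by rewrite normr_gt0 subr_eq0.
rewrite -(ler_pM2r n0) -normrM.
have -> : (d - (g y - g x) / (y - x)) * (y - x) = - (g y - g x - d * (y - x)).
  by field; rewrite subr_eq0.
by rewrite normrN; exact: Hr.
Qed.

Lemma is_deriveP (R : realType) (g : R -> R) (x d : R) :
  is_derive x (1 : R) g d <-> is_derive_within setT g x d.
Proof.
have E : is_derive x (1 : R) g d <->
    (h^-1 *: (g (h *: 1 + x) - g x) @[h --> (0:R)^'] --> d).
  split; first by case=> dg <-; exact: dg.
  move=> dg; apply: DeriveDef; first by apply/cvg_ex; exists d.
  exact: cvg_lim dg.
rewrite E is_derive_withinP; split.
  move=> /cvgrPdist_le h e e0; have [r /= r0 H] := h e e0.
  exists r => // y _ yr.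
  have [->|yx] := eqVneq y x; first by rewrite !subrr mulr0 subr0 normr0 mulr0.
  have yx0 : y - x != 0 by rewrite subr_eq0.
  have := H (y - x); rewrite /ball_/= sub0r normrN => /(_ yr yx0).
  have n0 : 0 < `|y - x| by rewrite normr_gt0.
  have -> : g y - g x - d * (y - x) = - (d - (g y - g x) / (y - x)) * (y - x).
    by field.
  rewrite normrM normrN ler_pM2r// scaler1 subrK.
  by rewrite /GRing.scale/= mulrC.
move=> H; apply/cvgrPdist_le => e e0; have [r r0 Hr] := H e e0.
exists r => //= y; rewrite /ball_ /= sub0r normrN => yr yx.
have n0 : 0 < `|y| by rewrite normr_gt0.
rewrite -(ler_pM2r n0) -normrM.
rewrite scaler1 /GRing.scale/=.
have -> : (d - y^-1 * (g (y + x) - g x)) * y = - (g (y + x) - g x - d * (y + x - x)).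
  by field.
by have := Hr (y + x) I; rewrite addrK => /(_ yr); rewrite normrN.
Qed.

Lemma within_continuous_precomp (S T U : topologicalType) (A : set T) (B : set S)
    (g : S -> T) (f : T -> U) :
  {within A, continuous f} -> continuous g -> (forall x, B x -> A (g x)) ->
  {within B, continuous (fun x => f (g x))}.
Proof.
move=> /subspace_continuousP cf cg BA; apply/subspace_continuousP => x Bx.
move=> P /(cf _ (BA _ Bx)); rewrite /within/= => H.
have := cg x _ H; rewrite /nbhs /=; apply: filterS => y /= Hy By; apply: Hy.
exact: BA.
Qed.

Lemma is_derive_cont (R : realType) (g : R -> R) (x d : R) :
  is_derive x (1 : R) g d -> {for x, continuous g}.
Proof. by case=> dg _; apply: differentiable_continuous; apply/derivable1_diffP. Qed.

Lemma is_derive_continuous (R : realType) (g dg : R -> R) :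
  (forall x, is_derive x (1 : R) g (dg x)) -> continuous g.
Proof. by move=> H x; exact: is_derive_cont. Qed.

Lemma within_continuousPe (R : realType) (A : set R) (g : R -> R) :
  {within A, continuous g} <-> forall x, A x -> forall e, 0 < e ->
    exists2 r, 0 < r & forall y, A y -> `|y - x| < r -> `|g y - g x| < e.
Proof.
split=> [/subspace_continuousP cg x Ax e e0|H].
  have /cvgrPdist_lt/(_ e e0) [r /= r0 H] := cg x Ax.
  exists r => // y Ay yr; rewrite distrC; apply: H => //.
  by rewrite /ball_/= distrC.
apply/subspace_continuousP => x Ax; apply/cvgrPdist_lt => e e0.
have [r r0 Hr] := H x Ax e e0; exists r => //= y; rewrite /ball_/= distrC.
by move=> yr Ay; rewrite distrC; exact: Hr.
Qed.

Lemma continuous_pair (S T U : topologicalType) (f : S -> T) (g : S -> U) :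
  continuous f -> continuous g -> continuous (fun x => (f x, g x)).
Proof. by move=> cf cg x; exact: (cvg_pair (cf x) (cg x)). Qed.

Section PointwiseRules.
Context {R : realType}.
Implicit Types (f g : R -> R) (x a b k : R).

Lemma is_derive_const k x : is_derive x (1 : R) (fun=> k) 0.
Proof. exact: is_derive_cst. Qed.

Lemma is_derive_add f g x a b : is_derive x (1 : R) f a ->
  is_derive x (1 : R) g b -> is_derive x (1 : R) (fun y => f y + g y) (a + b).
Proof. by move=> ? ?; exact: is_deriveD. Qed.

Lemma is_derive_opp f x a : is_derive x (1 : R) f a ->
  is_derive x (1 : R) (fun y => - f y) (- a).
Proof. by move=> ?; exact: is_deriveN. Qed.

Lemma is_derive_sub f g x a b : is_derive x (1 : R) f a ->
  is_derive x (1 : R) g b -> is_derive x (1 : R) (fun y => f y - g y) (a - b).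
Proof. by move=> ? ?; exact: is_deriveB. Qed.

Lemma is_derive_mul f g x a b : is_derive x (1 : R) f a ->
  is_derive x (1 : R) g b ->
  is_derive x (1 : R) (fun y => f y * g y) (a * g x + f x * b).
Proof.
move=> ? ?; have := is_deriveM (f := f) (g := g) (x := x) (v := 1).
move=> /(_ a b _ _) H; apply: is_derive_eq; rewrite /GRing.scale/=; ring.
Qed.

Lemma is_derive_chain f g x a b : is_derive (g x) (1 : R) f a ->
  is_derive x (1 : R) g b -> is_derive x (1 : R) (fun y => f (g y)) (a * b).
Proof. by move=> ? ?; exact: is_derive1_comp. Qed.

Lemma is_derive_idfun x : is_derive x (1 : R) (fun y => y) 1.
Proof. exact: is_derive_id. Qed.

Lemma is_derive_affine f x a (k m : R) : is_derive (k * x + m) (1 : R) f a ->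
  is_derive x (1 : R) (fun y => f (k * y + m)) (a * k).
Proof.
move=> Df; apply: is_derive_chain => //.
have := is_derive_add (is_derive_mul (is_derive_const k x) (is_derive_idfun x))
  (is_derive_const m x).
by rewrite mul0r add0r mulr1 addr0.
Qed.

End PointwiseRules.

Lemma is_derive_val (R : realType) (f : R -> R) (x a b : R) :
  is_derive x (1 : R) f a -> a = b -> is_derive x (1 : R) f b.
Proof. by move=> ? <-. Qed.

Lemma is_derive_inv (R : realType) (g : R -> R) (x d : R) : g x != 0 ->
  is_derive x (1 : R) g d ->
  is_derive x (1 : R) (fun y => (g y)^-1) (- d / g x ^+ 2).
Proof.
move=> gx [dg dE]; apply: DeriveDef; first exact: derivableV.
by rewrite deriveV// dE /GRing.scale/=; field.
Qed.

Lemma is_derive_expR_affine (R : realType) (A k s t : R) :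
  is_derive t (1 : R) (fun r => A * expR (k * (r - s)))
    (k * (A * expR (k * (t - s)))).
Proof.
have E : (fun r => A * expR (k * (r - s))) = (fun r => A * expR (k * r + - (k * s))).
  by apply/funext => r; rewrite mulrBr.
rewrite E; have D := is_derive_affine (is_derive_expR (k * t + - (k * s))).
apply: is_derive_val (is_derive_mul (is_derive_const A t) D) _.
by rewrite mulrBr; ring.
Qed.

Lemma is_derive_within_sub (R : realType) (A : set R) (g : R -> R) (x d : R) :
  is_derive x (1 : R) g d -> is_derive_within A g x d.
Proof.
move=> /is_deriveP/is_derive_withinP H; apply/is_derive_withinP => e e0.
by have [r r0 Hr] := H e e0; exists r => // y _; exact: Hr.
Qed.

Lemma is_derive_within_eq (R : realType) (A : set R) (g h : R -> R) (x d : R) :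
  A x -> (forall y, A y -> g y = h y) ->
  is_derive_within A g x d -> is_derive_within A h x d.
Proof.
move=> Ax gh /is_derive_withinP H; apply/is_derive_withinP => e e0.
have [r r0 Hr] := H e e0; exists r => // y Ay yr.
by rewrite -!gh//; exact: Hr.
Qed.

Lemma is_derive_eq_near (R : realType) (g h : R -> R) (x d r : R) :
  0 < r -> (forall y, `|y - x| < r -> g y = h y) ->
  is_derive x (1 : R) g d -> is_derive x (1 : R) h d.
Proof.
move=> r0 gh /is_deriveP/is_derive_withinP H.
apply/is_deriveP/is_derive_withinP => e e0.
have [r' r'0 Hr] := H e e0; exists (Num.min r r'); first by rewrite lt_min r0.
move=> y _; rewrite lt_min => /andP[yr yr'].
by rewrite -!gh ?subrr ?normr0//; exact: Hr.
Qed.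

Lemma is_derive_uniq (R : realType) (g : R -> R) (x d d' : R) :
  is_derive x (1 : R) g d -> is_derive x (1 : R) g d' -> d = d'.
Proof. by case=> _ <- [_ <-]. Qed.

(** * Maximum principle *)

(** If [g''(x)] were positive then [g'], which vanishes at [x], would be positive
    just to the right of [x], and [g] would increase there. *)
Lemma local_max_derive2 (R : realType) (g dg : R -> R) (x d2 e : R) :
  0 < e -> (forall y, `|y - x| < e -> is_derive y (1 : R) g (dg y)) ->
  is_derive x (1 : R) dg d2 -> (forall y, `|y - x| < e -> g y <= g x) ->
  dg x = 0 /\ d2 <= 0.
Proof.
move=> e0 Dg Ddg gm.
have xe y : y \in `](x - e), (x + e)[ -> `|y - x| < e.
  by rewrite in_itv/= ltr_norml => /andP[? ?]; apply/andP; split; lra.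
have dg0 : dg x = 0.
  have D0 : is_derive x (1 : R) g 0.
    apply: (@derive1_at_max _ g (x - e) (x + e)); first by lra.
    - by move=> t /xe /Dg [].
    - by rewrite in_itv/=; apply/andP; split; lra.
    - by move=> t /xe /gm.
  by have [_ <-] := Dg x ltac:(by rewrite subrr normr0); case: D0.
split=> //; rewrite leNgt; apply/negP => d20.
move: Ddg => /is_deriveP/is_derive_withinP/(_ (d2 / 2)) [|r r0 H]; first by lra.
pose h := Num.min r e / 2.
have hr : 0 < h /\ h < r /\ h < e.
  rewrite /h; have [re|re] := lerP r e; lra.
have pos z : x < z -> z <= x + h -> 0 < dg z.
  move=> xz zh; have := H z I; rewrite dg0 subr0.
  have -> : `|z - x| = z - x by apply: ger0_norm; lra.
  move=> /(_ ltac:(lra)); rewrite ler_norml => /andP[+ _].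
  have zx0 : 0 < z - x by lra.
  by have := mulr_gt0 d20 zx0; nra.
have [|||c cI E] := @MVT R g dg x (x + h).
- by lra.
- move=> z; rewrite in_itv/= => /andP[z1 z2]; apply: Dg.
  by rewrite ltr_norml; apply/andP; split; lra.
- apply: derivable_within_continuous => z; rewrite in_itv/= => /andP[z1 z2].
  have zx : `|z - x| < e by rewrite ltr_norml; apply/andP; split; lra.
  by case: (Dg z zx).
move: cI; rewrite in_itv/= => /andP[c1 c2].
have := gm (x + h); rewrite addrAC subrr add0r gtr0_norm; last by lra.
move=> /(_ ltac:(lra)); have := pos c c1 (ltW c2).
by move: E; rewrite addrAC subrr add0r => E p q; nra.
Qed.

Lemma derive_ge0_left_max (R : realType) (g : R -> R) (t d e : R) :
  0 < e -> is_derive t (1 : R) g d ->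
  (forall s, t - e < s -> s < t -> g s <= g t) -> 0 <= d.
Proof.
move=> e0 /is_deriveP/is_derive_withinP D gm; rewrite leNgt; apply/negP => d0.
have [|r r0 H] := D (- d / 2); first by lra.
pose h := Num.min r e / 2.
have [h0 [hr he]] : 0 < h /\ h < r /\ h < e.
  rewrite /h; have [re|re] := lerP r e; lra.
have := gm (t - h) ltac:(lra) ltac:(lra).
have := H (t - h) I; have -> : t - h - t = - h by lra.
rewrite normrN gtr0_norm// => /(_ hr); rewrite ler_norml => /andP[+ _]; nra.
Qed.

Lemma compact_preimage (R : realType) (T : topologicalType) (A : set T) (f : T -> R) :
  compact A -> {within A, continuous f} -> compact (A `&` [set z | 0 <= f z]).
Proof.
move=> cA /continuous_closedP cf.
have /closed_subspaceP[V cV VA] := cf _ (@closed_ge R 0).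
have -> : A `&` [set z | 0 <= f z] = A `&` V.
  by rewrite setIC (setIC A V) VA.
exact: compact_closedI.
Qed.

(** On the compact set where [G >= 0] the time attains its minimum; before that
    time [G < 0] everywhere, so [G <= 0] at that time by continuity. *)
Lemma first_touch (R : realType) (T : topologicalType) (K : set T)
    (G : T -> R -> R) (t0 t1 : R) :
  compact K -> {within K `*` `[t0, t1], continuous (fun z => G z.1 z.2)} ->
  (forall p, K p -> G p t0 < 0) ->
  (forall p t, K p -> t0 < t <= t1 -> G p t = 0 ->
     (forall p' t', K p' -> t0 <= t' <= t -> G p' t' <= 0) -> False) ->
  forall p t, K p -> t0 <= t <= t1 -> G p t < 0.
Proof.
move=> cK cG G0 touch p t Kp tI; rewrite ltNge; apply/negP => Gpt.
pose I := [set` `[t0, t1]].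
have cZ := compact_preimage (compact_setX cK (@segment_compact R t0 t1)) cG.
set Z := (X in compact X) in cZ.
have [||| [q s] /set_mem[[/= Kq sI] Gqs] qmin] := @compact_EVT_min _ R snd Z.
- by exists (p, t); split => //; split => //=; rewrite in_itv.
- exact: cZ.
- by apply: continuous_subspaceT => x; exact: cvg_snd.
move: sI; rewrite /= in_itv/= => /andP[s0 s1].
have neg p' t' : K p' -> t0 <= t' -> t' < s -> G p' t' < 0.
  move=> Kp' t'0 t's; rewrite ltNge; apply/negP => H.
  have /qmin/= : (p', t') \in Z.
    apply/mem_set; split => //; split => //=; rewrite in_itv/=; apply/andP; split; lra.
  by rewrite leNgt t's.
have s0' : t0 < s.
  rewrite lt_neqAle s0 andbT; apply/eqP => E; move: Gqs; rewrite /= -E.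
  by have := G0 q Kq; lra.
have le0 p' t' : K p' -> t0 <= t' <= s -> G p' t' <= 0.
  move=> Kp' /andP[t'0]; rewrite le_eqVlt => /orP[/eqP ->|t's]; last first.
    exact/ltW/neg.
  rewrite leNgt; apply/negP => Gp.
  have cG' : {within `[t0, t1], continuous (G p')}.
    apply: (within_continuous_precomp (g := fun x => (p', x)) cG).
      by apply: continuous_pair => x; [exact: cvg_cst|exact: cvg_id].
    by move=> x xI; split.
  have sI : s \in `[t0, t1] by rewrite in_itv/= s0.
  have [r r0 Hr] := (within_continuousPe _ _).1 cG' s sI _ Gp.
  pose h := Num.min r (s - t0) / 2.
  have [h0 [hr ht]] : 0 < h /\ h < r /\ h < s - t0.
    rewrite /h; have [re|re] := lerP r (s - t0); lra.
  have := Hr (s - h); have -> : s - h - s = - h by lra.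
  rewrite normrN gtr0_norm// => /(_ _ hr); rewrite ltr_norml => H.
  have /H/andP[+ _] : s - h \in `[t0, t1] by rewrite in_itv/=; apply/andP; split; lra.
  by have := neg p' (s - h) Kp' ltac:(lra) ltac:(lra); lra.
apply: (touch q s) => //; first by rewrite s0'.
by apply/le_anti; rewrite Gqs (le0 q s)// s0 lexx.
Qed.

(** * Functions shifted by a constant over a period *)

Section Periodic.
Context {R : realType}.
Implicit Types (l x : R).

Lemma shift_int (g : R -> R) l c : (forall x, g (x + 2 * l) = g x - c) ->
  forall x (k : int), g (x + 2 * l * k%:~R) = g x - c * k%:~R.
Proof.
move=> gs; have gn x (n : nat) : g (x + 2 * l * n%:R) = g x - c * n%:R.
  elim: n => [|n IH]; first by rewrite !mulr0 addr0 subr0.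
  by rewrite -[n.+1%:R]natr1 !(mulrDr _ n%:R) !mulr1 addrA gs IH; ring.
move=> x [n|n]; first exact: gn.
rewrite NegzE mulrNz mulrN.
have := gn (x - 2 * l * n.+1%:R) n.+1.
by rewrite subrK => ->; ring.
Qed.

Lemma floor_period l x : 0 < l ->
  x - 2 * l * (Num.floor ((x + l) / (2 * l)))%:~R \in `[- l, l[.
Proof.
move=> l0; have l2 : 0 < 2 * l by lra.
have /andP[] := floor_itv ((x + l) / (2 * l)).
rewrite ler_pdivlMr// ltr_pdivrMr// intrD rmorph1 => k1 k2.
by rewrite in_itv/=; apply/andP; split; lra.
Qed.

Lemma fundamental_domain l x : 0 < l ->
  exists k : int, x - 2 * l * k%:~R \in `[- l, l[.
Proof. by move=> l0; eexists; exact: floor_period. Qed.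

Lemma ltNl l : 0 < l -> - l <= l.
Proof. lra. Qed.

Lemma shift_bounded l c (g : R -> R) : 0 < l ->
  (forall x, g (x + 2 * l) = g x - c) ->
  {within `[- l, l], continuous g} ->
  exists P, forall x : R, `|g x + c / (2 * l) * x| <= P.
Proof.
move=> l0 gs cg; pose p x := g x + c / (2 * l) * x.
have cp : {within `[- l, l], continuous (fun x => `|p x|)}.
  apply: (@within_continuous_comp _ _ _ _ p (fun x => `|x|)).
    by move=> x _; exact: norm_continuous.
  move=> x; apply: cvgD; first exact: cg.
  apply: (@continuous_subspaceT _ _ _ (fun x => c / (2 * l) * x)) => {}x.
  by apply: cvgM; [exact: cvg_cst|exact: cvg_id].
have [P _ Pm] := EVT_max (ltNl l0) cp.
exists `|p P| => x; have [k] := fundamental_domain x l0.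
rewrite in_itv/= => /andP[k1 k2].
have -> : g x + c / (2 * l) * x = p (x - 2 * l * k%:~R).
  rewrite /p -{1}(subrK (2 * l * k%:~R) x) (shift_int gs).
  by field; rewrite gt_eqF.
by apply: Pm; rewrite in_itv/=; apply/andP; split; lra.
Qed.

End Periodic.

(** * Positivity of differences of solutions *)

(** What the difference of two solutions satisfies: the reaction terms differ by
    at most [`|w|]. Two periods are covered by the continuity hypothesis because
    points [x + s] with [x] and [s] each running over one period are compared. *)
Record heat_like (R : realType) (l : R) (w wx wxx wt : R -> R -> R) : Prop := {
  heat_per : forall x t : R, 0 <= t -> w (x + 2 * l) t = w x t ;
  heat_cont : {within `[- l, 3 * l] `*` `[0, +oo[,
    continuous (fun z : R * R => w z.1 z.2)} ;
  heat_dx : forall x t : R, 0 < t -> is_derive x (1 : R) (w^~ t) (wx x t) ;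
  heat_dxx : forall x t : R, 0 < t -> is_derive x (1 : R) (wx^~ t) (wxx x t) ;
  heat_dt : forall x t : R, 0 < t -> is_derive t (1 : R) (w x) (wt x t) ;
  heat_eq : forall x t : R, 0 < t -> `|wt x t - wxx x t| <= `|w x t| }.

Section HeatLike.
Context {R : realType} (l : R) (w wx wxx wt : R -> R -> R).
Hypothesis l0 : 0 < l.
Hypothesis hw : heat_like l w wx wxx wt.

Lemma heat_reduce x t : 0 <= t -> exists2 y, y \in `[- l, l] &
  (exists k : int, x = y + 2 * l * k%:~R) /\ w x t = w y t.
Proof.
move=> t0; have [k] := fundamental_domain x l0.
rewrite in_itv/= => /andP[k1 k2].
exists (x - 2 * l * k%:~R); first by rewrite in_itv/=; apply/andP; split; lra.
split; first by exists k; rewrite subrK.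
have sh y : w (y + 2 * l) t = w y t - 0 by rewrite (heat_per hw)// subr0.
rewrite -{1}(subrK (2 * l * k%:~R) x).
have := @shift_int R (w^~ t) l 0 sh (x - 2 * l * k%:~R) k.
by rewrite mul0r subr0.
Qed.

Lemma heat_cont_slab (t0 t1 : R) : 0 <= t0 ->
  {within `[- l, l] `*` `[t0, t1], continuous (fun z : R * R => w z.1 z.2)}.
Proof.
move=> t00; apply: continuous_subspaceW (heat_cont hw) => -[x t] /= [].
rewrite /= !in_itv/= => /andP[x1 x2] /andP[s1 s2].
split; rewrite /= ?in_itv/= ?andbT; last by lra.
by apply/andP; split; lra.
Qed.

Lemma heat_cont_at (t : R) : 0 <= t -> {within `[- l, l], continuous (w^~ t)}.
Proof.
move=> t0; apply: (within_continuous_precomp (g := fun x => (x, t)) (heat_cont hw)).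
  by apply: continuous_pair => x; [exact: cvg_id|exact: cvg_cst].
move=> x; rewrite /= !in_itv/= => /andP[x1 x2]; split; rewrite /= ?in_itv/= ?andbT//.
by apply/andP; split; lra.
Qed.

Lemma heat_pos_min (t : R) : 0 <= t -> (forall x, 0 < w x t) ->
  exists2 m, 0 < m & forall x, m <= w x t.
Proof.
move=> t0 wp; have [c cI cm] := EVT_min (ltNl l0) (heat_cont_at t0).
exists (w c t); first exact: wp.
by move=> x; have [y yI [_ ->]] := heat_reduce x t0; exact: cm.
Qed.

Lemma heat_max (t : R) : 0 <= t -> exists M, forall x, w x t <= M.
Proof.
move=> t0; have [c cI cm] := EVT_max (ltNl l0) (heat_cont_at t0).
exists (w c t) => x; have [y yI [_ ->]] := heat_reduce x t0; exact: cm.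
Qed.

(** Where [w] is smallest, [w_xx >= 0], so that [w] cannot decay faster than
    [exp (- t)]; the barrier decays like [exp (- 2 t)]. *)
Lemma heat_pos (t0 : R) : 0 <= t0 -> (forall x, 0 < w x t0) ->
  forall x t, t0 <= t -> 0 < w x t.
Proof.
move=> t00 /(heat_pos_min t00)[m m0 wm] x t t0t.
pose E s := m / 2 * expR (- 2 * (s - t0)).
have E0 s : 0 < E s by rewrite mulr_gt0 ?expR_gt0//; lra.
have [y yI [_ ->]] := heat_reduce x (le_trans t00 t0t).
suff : E t - w y t < 0 by have := E0 t; lra.
apply: (@first_touch R _ [set` `[- l, l]] (fun y s => E s - w y s) t0 t).
- exact: segment_compact.
- move=> z; apply: cvgB; last exact: heat_cont_slab.
  apply: (@continuous_subspaceT _ _ _ (fun z : R * R => E z.2)) => {}z.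
  apply: (@continuous_comp _ _ _ snd E); first exact: cvg_snd.
  exact: is_derive_cont (is_derive_expR_affine _ _ _ _).
- move=> p _; rewrite /E subrr mulr0 expR0 mulr1.
  by have := wm p; lra.
- move=> p s pI /andP[s0 s1] Es le0.
  have s00 : 0 < s by lra.
  have gm z : w p s <= w z s.
    have [q qI [_ ->]] := heat_reduce z (ltW s00).
    have := le0 q s qI ltac:(apply/andP; split; lra); lra.
  have [_ wxx0] := @local_max_derive2 R (fun z => - w z s) (fun z => - wx z s) p
    (- wxx p s) 1 ltac:(lra) (fun z _ => is_derive_opp (heat_dx hw z s00))
    (is_derive_opp (heat_dxx hw p s00)) ltac:(move=> z _; rewrite lerN2; exact: gm).
  have := @derive_ge0_left_max R (fun r => E r - w p r) s _ (s - t0) ltac:(lra)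
    (is_derive_sub (is_derive_expR_affine _ _ _ s) (heat_dt hw p s00)).
  rewrite -/(E s) => H.
  have /H : forall r, s - (s - t0) < r -> r < s -> E r - w p r <= E s - w p s.
    move=> r r1 r2; rewrite Es; apply: le0 => //; apply/andP; split; lra.
  have := heat_eq hw p s00; have wE : w p s = E s by lra.
  rewrite wE (gtr0_norm (E0 s)) ler_norml => /andP[+ _].
  by have := E0 s; lra.
- exact: yI.
- by rewrite t0t lexx.
Qed.

End HeatLike.

(** * Harnack inequality *)

Section Harnack.
Context {R : realType} (l : R) (w wx wxx wt : R -> R -> R) (t0 : R).
Hypothesis l0 : 0 < l.
Hypothesis hw : heat_like l w wx wxx wt.
Hypothesis t00 : 0 <= t0.
Hypothesis w0 : forall x, 0 < w x t0.

Let wp x t : t0 <= t -> 0 < w x t.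
Proof. exact: (heat_pos l0 hw t00 w0). Qed.

Let q x t := ln (w x t).
Let qx x t := wx x t * (w x t)^-1.
Let qxx x t := wxx x t * (w x t)^-1 + wx x t * (- wx x t / w x t ^+ 2).

Let q_dx x t : t0 < t -> is_derive x (1 : R) (q^~ t) (qx x t).
Proof.
move=> tt; have tp : 0 < t by exact: le_lt_trans tt.
have := is_derive_chain (is_derive1_ln (wp x (ltW tt))) (heat_dx hw x tp).
by rewrite mulrC.
Qed.

Let q_dxx x t : t0 < t -> is_derive x (1 : R) (qx^~ t) (qxx x t).
Proof.
move=> tt; have tp : 0 < t by exact: le_lt_trans tt.
apply: is_derive_mul; first exact: (heat_dxx hw).
apply: (is_derive_inv (g := w^~ t)); last exact: (heat_dx hw).
by rewrite gt_eqF// wp// ltW.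
Qed.

Let q_dt x t : t0 < t -> is_derive t (1 : R) (q x) (wt x t / w x t).
Proof.
move=> tt; have tp : 0 < t by exact: le_lt_trans tt.
have := is_derive_chain (is_derive1_ln (wp x (ltW tt))) (heat_dt hw x tp).
by rewrite mulrC.
Qed.

Let q_eq x t : t0 < t -> `|wt x t / w x t - qxx x t - qx x t ^+ 2| <= 1.
Proof.
move=> tt; have tp : 0 < t by exact: le_lt_trans tt.
have wp' := wp x (ltW tt).
have -> : wt x t / w x t - qxx x t - qx x t ^+ 2 = (wt x t - wxx x t) / w x t.
  by rewrite /qxx /qx; field; rewrite gt_eqF.
rewrite normrM normfV ler_pdivrMr ?normr_gt0 ?gt_eqF// mul1r.
exact: heat_eq hw x t tp.
Qed.

Variable A0 : R.
Hypothesis A0p : 0 <= A0.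
Hypothesis osc0 : forall x y, q y t0 - q x t0 <= A0.

(* The barrier for [q (x + s) t - q x t] is [k t * psi s]. The profile [psi] is
   concave with [psi'' = - 2], symmetric on the circle of length [2 * l], and
   positive at [s = 0], where the difference vanishes: contact occurs only at
   an interior [s]. The rate [4 / l ^+ 2] is [8] divided by [max psi]. *)
Let psi (s : R) := 2 * l ^+ 2 - (l - s) ^+ 2.
Let k (t : R) := A0 / l ^+ 2 * expR (- (4 / l ^+ 2) * (t - t0)) + 1.

Let k_ge1 t : 1 <= k t.
Proof.
by rewrite lerDr mulr_ge0 ?expR_ge0// divr_ge0// sqr_ge0.
Qed.

Let k_dt t : is_derive t (1 : R) k (- (4 / l ^+ 2) * (k t - 1)).
Proof.
apply: is_derive_val (is_derive_add (is_derive_expR_affine _ _ _ _)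
  (is_derive_const 1 t)) _.
by rewrite addr0 /k addrK.
Qed.

Let G (p : R * R) t := q (p.1 + p.2) t - q p.1 t - k t * psi p.2.

Let K : set (R * R) := [set` `[- l, l]] `*` [set` `[0, 2 * l]].

Let G_cont t1 : {within K `*` `[t0, t1], continuous (fun z => G z.1 z.2)}.
Proof.
have q_cont (g : (R * R) * R -> R * R) : continuous g ->
    (forall z, (K `*` [set` `[t0, t1]]) z ->
       (- l <= (g z).1 <= 3 * l) /\ t0 <= (g z).2) ->
    {within K `*` `[t0, t1], continuous (fun z => q (g z).1 (g z).2)}.
  move=> cg gI.
  apply: (@within_continuous_comp _ _ _ _ (fun z => w (g z).1 (g z).2) (@ln R)).
    move=> r /set_mem[z zI <-]; apply: continuous_ln; apply: wp.
    by have [_] := gI z zI.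
  apply: (within_continuous_precomp (heat_cont hw) cg) => z zI.
  have [g1 g2] := gI z zI; split => //=; rewrite in_itv/= andbT.
  exact: le_trans g2.
move=> z; apply: cvgB; first apply: cvgB.
- apply: (q_cont (fun z => (z.1.1 + z.1.2, z.2))).
    apply: continuous_pair => {}z; last exact: cvg_snd.
    apply: cvgD; apply: (@continuous_comp _ _ _ fst); try exact: cvg_fst.
    exact: cvg_snd.
  move=> -[[x s] t] [[/=]]; rewrite !in_itv/= => /andP[? ?] /andP[? ?] /andP[? ?].
  split => //; apply/andP; split; lra.
- apply: (q_cont (fun z => (z.1.1, z.2))).
    apply: continuous_pair => {}z; last exact: cvg_snd.
    by apply: (@continuous_comp _ _ _ fst); exact: cvg_fst.
  move=> -[[x s] t] [[/=]]; rewrite !in_itv/= => /andP[? ?] /andP[? ?] /andP[? ?].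
  split => //; apply/andP; split; lra.
- apply: (@continuous_subspaceT _ _ _ (fun z : (R * R) * R => k z.2 * psi z.1.2)).
  move=> {}z; apply: cvgM.
    apply: (@continuous_comp _ _ _ snd k); first exact: cvg_snd.
    exact: is_derive_cont (k_dt _).
  apply: cvgB; first exact: cvg_cst.
  have c : {for z, continuous (fun z : R * R * R => l - z.1.2)}.
    apply: cvgB; first exact: cvg_cst.
    by apply: (@continuous_comp _ _ _ fst snd); [exact: cvg_fst|exact: cvg_snd].
  by apply: cvgM.
Qed.

Let shift2l x t : t0 <= t -> q (x + 2 * l) t = q x t.
Proof. by move=> tt; rewrite /q (heat_per hw)// (le_trans t00). Qed.

Let shiftk x t (m : int) : t0 <= t -> q (x + 2 * l * m%:~R) t = q x t.
Proof.
move=> tt; rewrite (@shift_int _ (q^~ t) l 0) ?mul0r ?subr0// => y.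
by rewrite subr0 shift2l.
Qed.

Let psi_ends : psi 0 = l ^+ 2 /\ psi (2 * l) = l ^+ 2.
Proof. by split; rewrite /psi; ring. Qed.

Let psi_bounds s : 0 <= s <= 2 * l -> l ^+ 2 <= psi s <= 2 * l ^+ 2.
Proof.
move=> /andP[s0 s1]; rewrite /psi; apply/andP; split; last by have := sqr_ge0 (l - s); lra.
by have := mulr_ge0 s0 (_ : 0 <= 2 * l - s); rewrite subr_ge0 => /(_ s1); nra.
Qed.

Let psi_ds s : is_derive s (1 : R) psi (2 * (l - s)).
Proof.
have D : is_derive s (1 : R) (fun s => l - s) (0 - 1).
  exact: is_derive_sub (is_derive_const l s) (is_derive_idfun s).
apply: is_derive_val
  (is_derive_sub (is_derive_const (2 * l ^+ 2) s) (is_derive_mul D D)) _.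
by ring.
Qed.

Let no_touch p t : K p -> t0 < t -> G p t = 0 ->
  (forall p' t', K p' -> t0 <= t' <= t -> G p' t' <= 0) -> False.
Proof.
case: p => x s [/= xI]; rewrite in_itv/= => sI tt Gp le0.
have l2 : 0 < l ^+ 2 by rewrite exprn_gt0.
have t0t : t0 <= t by exact: ltW.
have le0' y r t' : 0 <= r <= 2 * l -> t0 <= t' <= t ->
    q (y + r) t' - q y t' <= k t' * psi r.
  move=> rI tI; have t'0 : t0 <= t' by case/andP: tI.
  have [z zI [[m E] _]] := heat_reduce l0 hw y (le_trans t00 t'0).
  have := le0 (z, r) t'; rewrite /G /= E (addrAC z) !shiftk//.
  by move=> H; rewrite -subr_le0; apply: H => //; split => //=; rewrite in_itv.
have [psi0 psi2] := psi_ends.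
have k1 := k_ge1 t.
have s0 : 0 < s.
  rewrite lt_neqAle; have /andP[-> _] := sI; rewrite andbT; apply/eqP => s0.
  by move: Gp; rewrite /G /= -s0 addr0 subrr psi0; nra.
have s2 : s < 2 * l.
  rewrite lt_neqAle; have /andP[_ ->] := sI; rewrite andbT; apply/eqP => s2.
  by move: Gp; rewrite /G /= s2 shift2l// subrr psi2; nra.
have Gs : q (x + s) t - q x t = k t * psi s by move: Gp; rewrite /G /=; lra.
(* Translating both points together shows that the slopes agree, so that the
     quadratic terms in the equation for [q] cancel. *)
have T1 : qx (x + s) t = qx x t.
  have D z : is_derive z (1 : R) (fun z => q (1 * z + s) t - q (1 * z + 0) t)
      (qx (1 * z + s) t * 1 - qx (1 * z + 0) t * 1).
    by apply: is_derive_sub; apply: (is_derive_affine (f := q^~ t)); exact: q_dx.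
  have D2 z : is_derive z (1 : R) (fun z => qx (1 * z + s) t * 1 - qx (1 * z + 0) t * 1)
      (qxx (1 * z + s) t * 1 * 1 + qx (1 * z + s) t * 0
       - (qxx (1 * z + 0) t * 1 * 1 + qx (1 * z + 0) t * 0)).
    apply: is_derive_sub; apply: is_derive_mul; try exact: is_derive_const.
      by apply: (is_derive_affine (f := qx^~ t)); exact: q_dxx.
    by apply: (is_derive_affine (f := qx^~ t)); exact: q_dxx.
  have [|E _] := @local_max_derive2 R _ _ x _ 1 ltac:(lra) (fun z _ => D z) (D2 x).
    move=> z _; rewrite !mul1r !addr0 Gs; apply: le0' => //.
    by rewrite t0t lexx.
  by move: E; rewrite !mul1r !addr0 !mulr1; lra.
(* Moving the two points apart at equal speed brings in the concavity of the
     barrier: [s] changes twice as fast, hence the factor [4] on [psi'']. *)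
have T2 : qxx (x + s) t - qxx x t + 8 * k t <= 0.
  pose e := Num.min s (2 * l - s) / 2.
  have [e0 [es es2]] : 0 < e /\ 2 * e <= s /\ 2 * e <= 2 * l - s.
    rewrite /e; have [re|re] := lerP s (2 * l - s); lra.
  pose d1 h := qx (1 * h + (x + s)) t * 1 - qx (-1 * h + x) t * -1
    - k t * (4 * (l - s - 2 * h)).
  have D h : is_derive h (1 : R) (fun h => q (1 * h + (x + s)) t - q (-1 * h + x) t
      - k t * psi (2 * h + s)) (d1 h).
    apply: is_derive_sub.
      by apply: is_derive_sub; apply: (is_derive_affine (f := q^~ t)); exact: q_dx.
    apply: is_derive_val (is_derive_mul (is_derive_const (k t) h)
      (is_derive_affine (psi_ds (2 * h + s)))) _.
    by ring.
  have D2 : is_derive 0 (1 : R) d1 (qxx (x + s) t - qxx x t + 8 * k t).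
    apply: is_derive_val (is_derive_sub (is_derive_sub
      (is_derive_mul (is_derive_affine (q_dxx _ tt)) (is_derive_const 1 0))
      (is_derive_mul (is_derive_affine (q_dxx _ tt)) (is_derive_const (-1) 0)))
      (is_derive_mul (is_derive_const (k t) 0)
        (is_derive_mul (is_derive_const 4 0) (is_derive_sub
          (is_derive_const (l - s) 0)
          (is_derive_mul (is_derive_const 2 0) (is_derive_idfun 0)))))) _.
    by rewrite !mulr0 !add0r; ring.
  have [|_ E] := @local_max_derive2 R _ d1 0 _ e e0 (fun z _ => D z) D2.
    move=> h; rewrite subr0 ltr_norml => /andP[h1 h2].
    rewrite !mulr0 !add0r Gs subrr.
    have := le0' (-1 * h + x) (2 * h + s) t; rewrite t0t lexx.
    have -> : -1 * h + x + (2 * h + s) = 1 * h + (x + s) by ring.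
    move=> /(_ ltac:(apply/andP; split; lra) isT); lra.
  exact: E.
have T3 : 0 <=
    wt (x + s) t / w (x + s) t - wt x t / w x t
    - (- (4 / l ^+ 2) * (k t - 1)) * psi s.
  apply: (@derive_ge0_left_max R
    (fun r => q (x + s) r - q x r - k r * psi s) t _ (t - t0)); first by lra.
    apply: is_derive_sub; first by apply: is_derive_sub; exact: q_dt.
    apply: is_derive_val (is_derive_mul (k_dt t) (is_derive_const (psi s) t)) _.
    by rewrite mulr0 addr0.
  move=> r r1 r2; rewrite Gs subrr subr_le0; apply: le0' => //.
  by apply/andP; split; lra.
have := q_eq (x + s) tt; have := q_eq x tt; rewrite !ler_norml T1.
move=> /andP[e1 _] /andP[_ e2].
have : 4 / l ^+ 2 * (k t - 1) * psi s <= 8 * (k t - 1).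
  have -> : 4 / l ^+ 2 * (k t - 1) * psi s = (4 * (k t - 1)) * (psi s / l ^+ 2).
    by field; rewrite gt_eqF.
  have : psi s / l ^+ 2 <= 2.
    by rewrite ler_pdivrMr//; case/andP: (psi_bounds sI).
  nra.
lra.
Qed.

(** The logarithm [q] of [w] solves [q_t = q_xx + q_x ^+ 2 + b] with [`|b| <= 1].
    The difference [q (x + s) t - q x t] cannot cross the barrier: at a contact
    [no_touch] bounds its time derivative by [- 8 * k t + 2], which is less than
    that of the barrier. *)
Lemma heat_log_osc x y t : t0 <= t ->
  ln (w y t) - ln (w x t) <=
  (A0 / l ^+ 2 * expR (- (4 / l ^+ 2) * (t - t0)) + 1) * (2 * l ^+ 2).
Proof.
move=> tt.
have l2 : 0 < l ^+ 2 by rewrite exprn_gt0.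
have cK : compact K by apply: compact_setX; exact: segment_compact.
have Glt p : K p -> G p t < 0.
  move=> Kp; apply: (first_touch cK (@G_cont t)) Kp _.
  - move=> [z s] [_ /=]; rewrite in_itv/= => sI; rewrite /G /=.
    have /andP[p1 _] := psi_bounds sI.
    have Al : 0 <= A0 / l ^+ 2 by rewrite divr_ge0// ltW.
    have : A0 / l ^+ 2 * l ^+ 2 = A0 by field; rewrite gt_eqF.
    rewrite /k subrr mulr0 expR0 mulr1.
    have := osc0 z (z + s); have := ler_wpM2l Al p1; lra.
  - by move=> p' s Kp' /andP[ts _]; exact: no_touch.
  - by rewrite tt lexx.
have [m] := fundamental_domain (y - x - l) l0; rewrite in_itv/= => /andP[s1 s2].
have [z zI [[m' E] _]] := heat_reduce l0 hw x (le_trans t00 tt).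
pose s := y - x - 2 * l * m%:~R.
have sI : 0 <= s <= 2 * l by rewrite /s; apply/andP; split; lra.
have := Glt (z, s) ltac:(split => //=; rewrite in_itv//).
rewrite /G /= -(shiftk (z + s) (m + m') tt) -(shiftk z m' tt) -E.
have -> : z + s + 2 * l * (m + m')%:~R = y by rewrite /s E intrD; ring.
rewrite subr_lt0 => /ltW/le_trans; apply.
rewrite ler_pM2l; last by have := k_ge1 t; lra.
by case/andP: (psi_bounds sI).
Qed.

End Harnack.

(** The factor comes from the barrier of [heat_log_osc] after long time: its
    height tends to [2 * l ^+ 2], and the summand [1] is for the transient. *)
Definition harnack_const (R : realType) (l : R) : R := expR (2 * l ^+ 2 + 1).

Lemma harnack_const_gt0 (R : realType) (l : R) : 0 < harnack_const l.
Proof. exact: expR_gt0. Qed.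

(** The constant depends on [l] only, and on no bound for [w]: this is what
    makes the estimate usable for a difference that is about to vanish. *)
Lemma heat_harnack (R : realType) (l : R) (w wx wxx wt : R -> R -> R) (t0 : R) :
  0 < l -> heat_like l w wx wxx wt -> 0 <= t0 -> (forall x, 0 < w x t0) ->
  exists2 t1, t0 <= t1 & forall t x y, t1 <= t ->
    w y t <= harnack_const l * w x t.
Proof.
move=> l0 hw t00 w0.
have l2 : 0 < l ^+ 2 by rewrite exprn_gt0.
have wp := heat_pos l0 hw t00 w0.
have [m m0 wm] := heat_pos_min l0 hw t00 w0.
have [M wM] := heat_max l0 hw t00.
have mM : m <= M by exact: le_trans (wm 0) (wM 0).
pose A0 := ln M - ln m.
have A00 : 0 <= A0 by rewrite subr_ge0 ler_ln// posrE; lra.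
have osc x y : ln (w y t0) - ln (w x t0) <= A0.
  by rewrite lerB// ler_ln ?posrE//; lra.
pose tau := A0 * l ^+ 2 / 2.
exists (t0 + tau); first by rewrite lerDl /tau divr_ge0// mulr_ge0// ltW.
move=> t x y tt.
have tau0 : 0 <= tau by rewrite /tau divr_ge0// mulr_ge0// ltW.
have t0t : t0 <= t by lra.
rewrite -ler_pdivrMr ?wp// /harnack_const -ler_ln ?posrE ?expR_gt0 ?divr_gt0 ?wp//.
rewrite ln_div ?posrE ?wp// expRK.
apply: le_trans (heat_log_osc l0 hw t00 w0 A00 osc _ _ t0t) _.
set e := expR _.
have : 2 * A0 * e <= 1.
  rewrite /e mulNr expRN -ler_pdivlMr ?invr_gt0 ?expR_gt0// invrK mul1r.
  apply: le_trans (expR_ge1Dx _).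
  have -> : 2 * A0 = 4 / l ^+ 2 * tau by rewrite /tau; field; rewrite gt_eqF.
  have : 4 / l ^+ 2 * tau <= 4 / l ^+ 2 * (t - t0).
    by rewrite ler_wpM2l//; [rewrite divr_ge0// ltW | lra].
  lra.
have -> : (A0 / l ^+ 2 * e + 1) * (2 * l ^+ 2) = 2 * A0 * e + 2 * l ^+ 2.
  by field; rewrite gt_eqF.
lra.
Qed.

(** * Flows and travelling waves *)

(** A solution of the phase equation unrolled from the circle to the whole line;
    the winding number appears as the loss [c] over each period. *)
Record phase_flow (R : realType) (f : R -> R) (l c : R)
    (v vx vxx vt : R -> R -> R) : Prop := {
  flow_shift : forall x t : R, 0 <= t -> v (x + 2 * l) t = v x t - c ;
  flow_cont : {within `[- l, 3 * l] `*` `[0, +oo[,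
    continuous (fun z : R * R => v z.1 z.2)} ;
  flow_dx : forall x t : R, 0 < t -> is_derive x (1 : R) (v^~ t) (vx x t) ;
  flow_dxx : forall x t : R, 0 < t -> is_derive x (1 : R) (vx^~ t) (vxx x t) ;
  flow_dt : forall x t : R, 0 < t -> is_derive t (1 : R) (v x) (vt x t) ;
  flow_eq : forall x t : R, 0 < t -> vt x t = vxx x t + f (v x t) }.

Lemma flow_sub (R : realType) (f : R -> R) (l c : R)
    (v vx vxx vt w wx wxx wt : R -> R -> R) :
  (forall x y, `|f x - f y| <= `|x - y|) ->
  phase_flow f l c v vx vxx vt -> phase_flow f l c w wx wxx wt ->
  heat_like l (fun x t => v x t - w x t) (fun x t => vx x t - wx x t)
    (fun x t => vxx x t - wxx x t) (fun x t => vt x t - wt x t).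
Proof.
move=> fL hv hw; split.
- by move=> x t t0; rewrite (flow_shift hv)// (flow_shift hw)//; ring.
- by move=> z; apply: cvgB; [exact: flow_cont hv z|exact: flow_cont hw z].
- move=> x t t0; exact: is_derive_sub (flow_dx hv x t0) (flow_dx hw x t0).
- move=> x t t0; exact: is_derive_sub (flow_dxx hv x t0) (flow_dxx hw x t0).
- move=> x t t0; exact: is_derive_sub (flow_dt hv x t0) (flow_dt hw x t0).
- move=> x t t0; rewrite (flow_eq hv)// (flow_eq hw)//.
  apply: le_trans (fL _ _); rewrite le_eqVlt; apply/orP; left; apply/eqP.
  by congr (`| _ |); ring.
Qed.

Section Wave.
Context {R : realType} (f : R -> R) (l c a : R) (u du : R -> R).
Hypothesis fL : forall x y, `|f x - f y| <= `|x - y|.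
Hypothesis l0 : 0 < l.
Hypothesis c0 : 0 < c.
Hypothesis us : forall x, u (x + 2 * l) = u x - c.
Hypothesis dus : forall x, du (x + 2 * l) = du x.
Hypothesis u_dx : forall x, is_derive x (1 : R) u (du x).
Hypothesis du_dx : forall x, is_derive x (1 : R) du (- a * du x - f (u x)).

Lemma wave_flow s : phase_flow f l c (fun x t => u (x - a * t - s))
  (fun x t => du (x - a * t - s))
  (fun x t => - a * du (x - a * t - s) - f (u (x - a * t - s)))
  (fun x t => - a * du (x - a * t - s)).
Proof.
have E1 t : (fun x => x - a * t - s) = (fun x => 1 * x + (- a * t - s)).
  by apply/funext => x; ring.
have Ex (g : R -> R) t :
    (fun x => g (x - a * t - s)) = (fun x => g (1 * x + (- a * t - s))).
  by apply/funext => x; congr g; ring.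
have Et (g : R -> R) x :
    (fun t => g (x - a * t - s)) = (fun t => g (- a * t + (x - s))).
  by apply/funext => t; congr g; ring.
split.
- move=> x t _.
  by rewrite -us; congr u; ring.
- apply: (@continuous_subspaceT _ _ _ (fun z : R * R => u (z.1 - a * z.2 - s))).
  move=> z; apply: (@continuous_comp _ _ _ (fun z : R * R => z.1 - a * z.2 - s) u).
    apply: cvgB; last exact: cvg_cst.
    apply: cvgB; first exact: cvg_fst.
    by apply: cvgM; [exact: cvg_cst|exact: cvg_snd].
  exact: is_derive_cont (u_dx _).
- move=> x t _; rewrite /= Ex; apply: is_derive_val (is_derive_affine (u_dx _)) _.
  by rewrite mulr1; congr du; ring.
- move=> x t _; rewrite /= Ex; apply: is_derive_val (is_derive_affine (du_dx _)) _.
  have -> : 1 * x + (- a * t - s) = x - a * t - s by ring.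
  by rewrite mulr1.
- move=> x t _; rewrite /= Et; apply: is_derive_val (is_derive_affine (u_dx _)) _.
  have -> : - a * t + (x - s) = x - a * t - s by ring.
  by rewrite mulrC.
- by move=> x t _; ring.
Qed.

Lemma wave_lipschitz : exists2 L, 0 < L & forall x y, `|u x - u y| <= L * `|x - y|.
Proof.
have [||L HL] := @shift_bounded R l 0 du l0.
- by move=> x; rewrite subr0.
- by apply: continuous_subspaceT; exact: is_derive_continuous du_dx.
have L0 : 0 <= L by exact: le_trans (HL 0).
exists (L + 1); first by lra.
move=> x y; wlog xy : x y / y <= x.
  move=> H; have [/H //|/ltW/H] := leP y x.
  by rewrite distrC (distrC y).
have [|z _ ->] := @MVT_segment R u du y x xy.
  by apply: continuous_subspaceT; exact: is_derive_continuous u_dx.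
rewrite normrM ler_wpM2r//.
by have := HL z; rewrite mul0r mul0r addr0; lra.
Qed.

Lemma wave_bounded : exists P, forall x, `|u x + c / (2 * l) * x| <= P.
Proof.
apply: shift_bounded => //.
by apply: continuous_subspaceT; exact: is_derive_continuous u_dx.
Qed.

Local Notation C := (harnack_const l).
Let C0 : 0 < C. Proof. exact: harnack_const_gt0. Qed.
Let C1 : 0 < C + 1. Proof. by rewrite addr_gt0. Qed.

(** The difference of two translates of the wave travels without changing shape,
    so the large time estimate holds at time [0]. *)
Lemma wave_harnack h : (forall x, u (x + h) < u x) ->
  forall x y, u y - u (y + h) <= C * (u x - u (x + h)).
Proof.
move=> uh.
have hw := flow_sub fL (wave_flow 0) (wave_flow (- h)).
have pos x : 0 < u (x - a * 0 - 0) - u (x - a * 0 - - h).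
  by rewrite mulr0 !subr0 opprK subr_gt0.
have [t1 _ H] := heat_harnack l0 hw (lexx 0) pos.
move=> x y; have := H t1 (x + a * t1) (y + a * t1) (lexx _).
by rewrite !addrK !subr0 !opprK.
Qed.

Lemma wave_drop : exists H, forall h x, H <= h -> u (x + h) < u x.
Proof.
have [P HP] := wave_bounded; pose k := c / (2 * l).
have k0 : 0 < k by rewrite divr_gt0// mulr_gt0.
exists ((2 * P + 1) / k) => h x; rewrite ler_pdivrMr// => hh.
have := HP x; have := HP (x + h); rewrite -/k !ler_norml.
by move=> /andP[_ p1] /andP[p2 _]; lra.
Qed.

(** Sliding: let [m] be the smallest shift beyond which all translates lie
    strictly below [u]. The Harnack inequality passes to the limit [m], so a
    contact of [u] with its translate by [m] forces [u (y + m) >= u y] for all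
    [y], against the drop over large distances. Without a contact the gap is
    bounded below and a smaller shift would do, unless [m = 0]. *)
Lemma wave_decreasing x y : x < y -> u y < u x.
Proof.
suff H h : 0 < h -> forall x, u (x + h) < u x.
  by move=> xy; have := H (y - x); rewrite subr_gt0 => /(_ xy x); rewrite addrC subrK.
move=> h0; apply: contrapT => nH.
pose S := [set s : R | forall s' x, s <= s' -> u (x + s') < u x].
have [Hd Sd] := wave_drop.
have S0 : S !=set0 by exists Hd => s' x'; exact: Sd.
have Sh s : S s -> h < s.
  move=> Ss; rewrite ltNge; apply/negP => sh; apply: nH => z; exact: Ss.
have iS : has_inf S by split => //; exists h => s /Sh/ltW.
pose m := inf S.
have m0 : 0 < m.
  by apply: lt_le_trans h0 _; apply: lb_le_inf => // s /Sh/ltW.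
have [L L0 HL] := wave_lipschitz.
have Sm s : m < s -> forall z, u (z + s) < u z.
  move=> ms z; have [s1 Ss1 s1s] := inf_lt S0 ms.
  by apply: Ss1; exact: ltW.
have lim z y' : u y' - u (y' + m) <= C * (u z - u (z + m)).
  rewrite leNgt; apply/negP => gap.
  pose g := u y' - u (y' + m) - C * (u z - u (z + m)).
  have g0 : 0 < g by rewrite subr_gt0.
  pose e := g / (2 * (C + 1) * L).
  have e0 : 0 < e by rewrite divr_gt0// mulr_gt0// mulr_gt0//.
  have eE : (C + 1) * (L * e) = g / 2.
    by rewrite /e; field; rewrite !gt_eqF.
  have := wave_harnack (Sm (m + e) ltac:(lra)) z y'.
  have Le v : `|u (v + m) - u (v + (m + e))| <= L * e.
    have := HL (v + m) (v + (m + e)).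
    have -> : v + m - (v + (m + e)) = - e by ring.
    by rewrite normrN (gtr0_norm e0).
  have := Le z; have := Le y'; rewrite !ler_norml => /andP[p1 p2] /andP[p3 p4] p5.
  have := ler_wpM2l (ltW C0) p4; rewrite /g in g0 eE; lra.
have mpos z : 0 < u z - u (z + m).
  rewrite ltNge; apply/negP => z0.
  have ge v : u v <= u (v + m).
    rewrite -subr_le0; apply: le_trans (lim z v) _.
    by rewrite pmulr_rle0.
  have gen v (n : nat) : u v <= u (v + m *+ n).
    elim: n => [|n IH]; first by rewrite mulr0n addr0.
    by rewrite mulrSr addrA; exact: le_trans IH (ge _).
  have := Sd (m *+ (Num.truncn (Hd / m)).+1) 0.
  rewrite ltNge gen => H; suff : false by []; apply: H.
  rewrite -mulr_natl -ler_pdivrMr//; apply/ltW; exact: truncnS_gt.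
have pos z : 0 < u (z - a * 0 - 0) - u (z - a * 0 - - m).
  by rewrite mulr0 !subr0 opprK.
have [mu mu0 Hmu] :=
  heat_pos_min l0 (flow_sub fL (wave_flow 0) (wave_flow (- m))) (lexx 0) pos.
pose d := Num.min m (mu / L) / 2.
have [d0 [dm dL]] : 0 < d /\ d < m /\ d < mu / L.
  have muL : 0 < mu / L by rewrite divr_gt0.
  by rewrite /d; have [re|re] := lerP m (mu / L); lra.
suff /(ge_inf iS.2) : S (m - d) by rewrite -/m; lra.
move=> s z sm; have [/Sm//|sm'] := ltP m s.
have := Hmu z; rewrite mulr0 !subr0 opprK => Hz.
have := HL (z + s) (z + m); have -> : z + s - (z + m) = - (m - s) by ring.
have ms0 : 0 <= m - s by rewrite subr_ge0.
rewrite normrN (ger0_norm ms0) ler_norml => /andP[_ p].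
have : L * (m - s) <= L * d by rewrite (ler_wpM2l (ltW L0))//; lra.
move: dL; rewrite ltr_pdivlMr// mulrC; lra.
Qed.

Section Convergence.
Context {v vx vxx vt : R -> R -> R}.
Hypothesis hv : phase_flow f l c v vx vxx vt.

Let P_ex : exists P, forall s x,
  (P <= s -> v x 0 < u (x - s)) /\ (s <= - P -> u (x - s) < v x 0).
Proof.
have [P HP] := wave_bounded.
have [Q HQ] : exists Q, forall x, `|v x 0 + c / (2 * l) * x| <= Q.
  apply: shift_bounded => //; first by move=> x; rewrite (flow_shift hv).
  apply: (within_continuous_precomp (g := fun x => (x, 0)) (flow_cont hv)).
    by apply: continuous_pair => x; [exact: cvg_id|exact: cvg_cst].
  move=> x; rewrite /= !in_itv/= => /andP[x1 x2]; split; rewrite /= ?in_itv/= ?lexx//.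
  by apply/andP; split; lra.
pose k := c / (2 * l); have k0 : 0 < k by rewrite divr_gt0// mulr_gt0.
exists ((P + Q + 1) / k) => s x.
have := HP (x - s); have := HQ x; rewrite -/k !ler_norml.
move=> /andP[q1 q2] /andP[p1 p2].
by split; [rewrite ler_pdivrMr//|rewrite lerNr ler_pdivrMr//]; lra.
Qed.

(** Let [s0] be the infimum of the shifts [s] for which the translated wave is
    above the solution at some time, and hence at all later times. Slightly
    above [s0] the difference [w] is positive but has a small minimum, since a
    shift slightly below [s0] is never admissible; by the Harnack inequality its
    maximum is eventually small as well. *)
Lemma flow_converges : exists s0, forall e, 0 < e ->
  exists2 T, 0 <= T & forall x t, T <= t -> `|v x t - u (x - a * t - s0)| <= e.
Proof.
have [P HP] := P_ex.
pose S := [set s : R | exists2 t, 0 <= t & forall x, v x t < u (x - a * t - s)].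
have S0 : S !=set0.
  by exists P, 0 => // x; rewrite mulr0 subr0; exact: (HP P x).1.
have above x t : 0 <= t -> u (x - a * t - - P) < v x t.
  move=> t0; rewrite -subr_gt0.
  apply: (heat_pos l0 (flow_sub fL hv (wave_flow (- P))) (lexx 0)) => // z.
  by rewrite subr_gt0 mulr0 subr0; apply: (HP _ _).2.
have Slb : has_lbound S.
  exists (- P) => s [t t0 Hs]; rewrite leNgt; apply/negP => sP.
  have := lt_trans (above 0 t t0) (Hs 0); rewrite ltNge => /negP; apply.
  by apply/ltW/wave_decreasing; lra.
exists (inf S); set s0 := inf S => e e0.
have [L L0 HL] := wave_lipschitz.
pose h := e / (2 * (C + 1) * L).
have h0 : 0 < h by rewrite divr_gt0// mulr_gt0// mulr_gt0//.
have hE : (C + 1) * (2 * L * h) = e.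
  by rewrite /h; field; rewrite !gt_eqF.
have [s1 [t1 t10 Hs1] s1s] : exists2 s, S s & s < s0 + h.
  by apply: inf_lt => //; rewrite -/s0; lra.
have hw := flow_sub fL (wave_flow (s0 + h)) hv.
have w0 x : 0 < u (x - a * t1 - (s0 + h)) - v x t1.
  rewrite subr_gt0; apply: lt_trans (Hs1 x) _; apply: wave_decreasing; lra.
have wp := heat_pos l0 hw t10 w0.
have [T t1T HT] := heat_harnack l0 hw t10 w0.
have T0 : 0 <= T by lra.
exists T => // x t Tt.
have [z Hz] : exists z, u (z - a * t - (s0 - h)) <= v z t.
  apply: contrapT => nex.
  have : S (s0 - h).
    exists t; first by lra.
    by move=> z; rewrite ltNge; apply/negP => ?; apply: nex; exists z.
  by move=> /(ge_inf Slb); rewrite -/s0; lra.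
have := HT t z x Tt; have := wp x t ltac:(lra).
have := HL (z - a * t - (s0 + h)) (z - a * t - (s0 - h)).
have -> : z - a * t - (s0 + h) - (z - a * t - (s0 - h)) = - (2 * h) by ring.
have := HL (x - a * t - (s0 + h)) (x - a * t - s0).
have -> : x - a * t - (s0 + h) - (x - a * t - s0) = - h by ring.
have h2 : 0 < 2 * h by rewrite mulr_gt0.
rewrite !normrN (gtr0_norm h0) (gtr0_norm h2).
rewrite !ler_norml => /andP[p1 p2] /andP[p3 p4] p5 p6.
have p7 : u (z - a * t - (s0 + h)) - v z t <= 2 * L * h by lra.
have := ler_wpM2l (ltW C0) p7.
have : 0 < L * h by rewrite mulr_gt0.
by move=> ? ?; apply/andP; split; lra.
Qed.

End Convergence.

End Wave.

(** * Gluing periods *)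

Section Gluing.
Context {R : realType} (l c : R).
Hypothesis l0 : 0 < l.
Implicit Types (g d : R -> R).

(** At [- l] the derivative from the left is the one-sided derivative at [l],
    transported by the shift. *)
Lemma glue_derive g d : (forall x : R, g (x + 2 * l) = g x - c) ->
  (forall x : R, d (x + 2 * l) = d x) ->
  (forall x : R, x \in `[- l, l] -> is_derive_within [set` `[- l, l]] g x (d x)) ->
  forall x : R, is_derive x (1 : R) g (d x).
Proof.
move=> gs ds gd.
have base x : x \in `[- l, l[ -> is_derive x (1 : R) g (d x).
  rewrite in_itv/= le_eqVlt => /andP[/orP[/eqP <- _|x1 x2]].
    apply/is_deriveP/is_derive_withinP => e e0.
    have [|r r0 Hr] := (is_derive_withinP _ _ _ _).1 (gd (- l) _) e e0.
      by rewrite in_itv/= lexx ltNl.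
    have [|r' r'0 Hr'] := (is_derive_withinP _ _ _ _).1 (gd l _) e e0.
      by rewrite in_itv/= lexx ltNl.
    exists (Num.min (Num.min r r') (2 * l)).
      by rewrite !lt_min r0 r'0 mulr_gt0.
    move=> y _; rewrite !lt_min => /andP[/andP[yr yr'] yl].
    move: (yl); rewrite ltr_norml => /andP[y1 y2].
    have [ly|ly] := leP (- l) y.
      by apply: Hr => //=; rewrite ?in_itv/=; apply/andP; split; lra.
    have E1 : g y = g (y + 2 * l) + c by rewrite gs; ring.
    have E2 : g (- l) = g l + c.
      by have := gs (- l); rewrite (_ : - l + 2 * l = l); [lra|ring].
    have E3 : d (- l) = d l by rewrite -ds; congr d; ring.
    have E4 : y - - l = y + 2 * l - l by ring.
    rewrite E1 E2 E3 opprD addrACA subrr addr0 E4; apply: Hr'.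
      by rewrite /= ?in_itv/=; apply/andP; split; lra.
    by rewrite -E4.
  have xI : x \in `[- l, l] by rewrite in_itv/=; apply/andP; split; lra.
  apply/is_deriveP/is_derive_withinP => e e0.
  have [r r0 Hr] := (is_derive_withinP _ _ _ _).1 (gd x xI) e e0.
  exists (Num.min r (Num.min (x + l) (l - x))).
    by rewrite !lt_min r0/=; apply/andP; split; lra.
  move=> y _; rewrite !lt_min !ltr_norml.
  move=> /andP[/andP[y1 y2] /andP[/andP[y3 y4] /andP[y5 y6]]].
  apply: Hr; first by rewrite /= ?in_itv/=; apply/andP; split; lra.
  by rewrite ltr_norml y1 y2.
move=> x; have [k kI] := fundamental_domain x l0.
have gE y : g y = g (1 * y + - (2 * l * k%:~R)) - c * k%:~R.
  by rewrite mul1r -(shift_int gs) subrK.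
have dE : d x = d (x - 2 * l * k%:~R).
  have ds0 y : d (y + 2 * l) = d y - 0 by rewrite subr0.
  by rewrite -{1}(subrK (2 * l * k%:~R) x) (shift_int ds0) mul0r subr0.
have -> : g = (fun y => g (1 * y + - (2 * l * k%:~R)) - c * k%:~R).
  by apply/funext => y; exact: gE.
apply: is_derive_val (is_derive_sub (is_derive_affine (base _ _)) (is_derive_const _ _)) _.
  by rewrite mul1r.
by rewrite dE mul1r mulr1 subr0.
Qed.

Definition unroll g (x : R) :=
  let k := Num.floor ((x + l) / (2 * l)) in g (x - 2 * l * k%:~R) - c * k%:~R.

Lemma unroll_shift g x : unroll g (x + 2 * l) = unroll g x - c.
Proof.
rewrite /unroll.
have -> : (x + 2 * l + l) / (2 * l) = (x + l) / (2 * l) + 1%:~R.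
  by field; rewrite gt_eqF.
rewrite floorDrz ?intr_int// intrKfloor intrD rmorph1.
rewrite mulrDr mulr1 opprD.
have -> : x + 2 * l + (- (2 * l * (Num.floor ((x + l) / (2 * l)))%:~R) - 2 * l) =
  x - 2 * l * (Num.floor ((x + l) / (2 * l)))%:~R by ring.
ring.
Qed.

Lemma unroll_id g x : g (- l) = g l + c -> x \in `[- l, l] -> unroll g x = g x.
Proof.
move=> gl; rewrite in_itv/= => /andP[x1]; have l2 : 0 < 2 * l by rewrite mulr_gt0.
rewrite le_eqVlt => /orP[/eqP ->|x2]; rewrite /unroll.
  have -> : (l + l) / (2 * l) = 1%:~R by field; rewrite gt_eqF.
  rewrite intrKfloor !mulr1; have -> : l - 2 * l = - l by ring.
  by rewrite gl addrK.
rewrite (_ : Num.floor _ = 0) ?mulr0 ?subr0//.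
apply: floor_def; rewrite add0r mulr0z mulr1z.
have := l0 => l0'; rewrite ltr_pdivrMr// mul1r divr_ge0 ?(ltW l2)//; lra.
Qed.

End Gluing.

Lemma unroll_spec (R : realType) (l x : R) : 0 < l ->
  exists2 k : int, x - 2 * l * k%:~R \in `[- l, l] &
    forall c g, unroll l c g x = g (x - 2 * l * k%:~R) - c * k%:~R.
Proof.
move=> l0; exists (Num.floor ((x + l) / (2 * l))) => //.
exact: (subset_itv_co_cc (floor_period x l0)).
Qed.

(** * Smoothness of the wave profile *)

Section Endpoint.
Context {R : realType} (l : R).
Hypothesis l0 : 0 < l.
Local Notation I := ([set` `[- l, l]] : set R).

(** The intermediate point lies between [e] and [y], whichever side of [e] the
    point [y] is on. *)
Lemma MVT_point (g dg : R -> R) (e y : R) :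
  {within I, continuous g} ->
  (forall x : R, x \in `]- l, l[ -> is_derive x (1 : R) g (dg x)) ->
  e \in `[- l, l] -> y \in `[- l, l] -> y != e ->
  exists z, [/\ z \in `]- l, l[, `|z - e| <= `|y - e|, `|z - y| <= `|y - e| &
    g y - g e = dg z * (y - e)].
Proof.
move=> cg dgP; rewrite !in_itv/= => /andP[e1 e2] /andP[y1 y2] ye.
have sub (p q : R) : - l <= p -> q <= l -> {within `[p, q], continuous g}.
  move=> p1 q1; have pqI (z : R) : z \in `[p, q] -> z \in `[- l, l].
    by rewrite !in_itv/= => /andP[? ?]; apply/andP; split; lra.
  exact: continuous_subspaceW pqI cg.
have sub' (p q z : R) : - l <= p -> q <= l -> z \in `]p, q[ -> z \in `]- l, l[.
  by move=> p1 q1; rewrite !in_itv/= => /andP[? ?]; apply/andP; split; lra.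
have [ly|ly] := ltP y e.
  have [z zI E] := MVT ly (fun z zI => dgP z (sub' _ _ _ y1 e2 zI)) (sub _ _ y1 e2).
  exists z; split; first exact: (sub' y e).
  - move: zI; rewrite in_itv/= => /andP[? ?]; rewrite !ltr0_norm; lra.
  - move: zI; rewrite in_itv/= => /andP[? ?].
    by rewrite gtr0_norm ?ltr0_norm; lra.
  - lra.
have {}ly : e < y by rewrite lt_neqAle eq_sym ye.
have [z zI E] := MVT ly (fun z zI => dgP z (sub' _ _ _ e1 y2 zI)) (sub _ _ e1 y2).
exists z; split => //; first exact: (sub' e y).
- move: zI; rewrite in_itv/= => /andP[? ?]; rewrite !gtr0_norm; lra.
- move: zI; rewrite in_itv/= => /andP[? ?].
  by rewrite ltr0_norm ?gtr0_norm; lra.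
Qed.

Context (f u v : R -> R) (a M : R).
Hypothesis cf : continuous f.
Hypothesis fM : forall x, `|f x| <= M.
Hypothesis cu : {within I, continuous u}.
Hypothesis u_dx : forall x : R, x \in `]- l, l[ -> is_derive x (1 : R) u (v x).
Hypothesis v_dx : forall x : R, x \in `]- l, l[ ->
  is_derive x (1 : R) v (- a * v x - f (u x)).
Hypothesis uN : is_derive_within I u (- l) (v (- l)).
Hypothesis ul : is_derive_within I u l (v l).

Let in_open_closed x : x \in `]- l, l[ -> x \in `[- l, l].
Proof. by rewrite !in_itv/= => /andP[? ?]; apply/andP; split; exact: ltW. Qed.

Let M0 : 0 <= M. Proof. exact: le_trans (fM 0). Qed.

(* The derivative of [v + a * u] is the bounded function [- f (u x)]. *)
Let flux_lipschitz x y : x \in `]- l, l[ -> y \in `]- l, l[ ->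
  `|(v x + a * u x) - (v y + a * u y)| <= M * `|x - y|.
Proof.
wlog xy : x y / y <= x.
  move=> H xI yI; have [yx|/ltW yx] := leP y x; first exact: H.
  by rewrite distrC (distrC x); exact: H.
rewrite !in_itv/= => /andP[x1 x2] /andP[y1 y2].
have D z : z \in `[y, x] -> is_derive z (1 : R) (fun z => v z + a * u z) (- f (u z)).
  rewrite in_itv/= => /andP[z1 z2].
  have zI : z \in `]- l, l[ by rewrite in_itv/=; apply/andP; split; lra.
  apply: is_derive_val (is_derive_add (v_dx zI)
    (is_derive_mul (is_derive_const a z) (u_dx zI))) _.
  by ring.
have cD : {within [set` `[y, x]], continuous (fun z => v z + a * u z)}.
  by apply: derivable_within_continuous => z /D [].
have [z _ ->] := MVT_segment xy (fun z zI => D z (subset_itv_oo_cc zI)) cD.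
by rewrite normrM normrN ler_wpM2r.
Qed.

(** The mean value theorem gives nearby points where [v] is close to its value
    at the endpoint, and there [v] is a Lipschitz function minus [a u]. *)
Lemma slope_cont_within e : e \in `[- l, l] -> is_derive_within I u e (v e) ->
  forall eps, 0 < eps -> exists2 r, 0 < r & forall y, y \in `]- l, l[ ->
    `|y - e| < r -> `|v y - v e| < eps.
Proof.
move=> eI /is_derive_withinP ue eps eps0.
have [|r1 r10 H1] := ue (eps / 4); first by lra.
have A0 : 0 < `|a| + 1 by rewrite ltr_wpDl.
have [|r2 r20 H2] := (within_continuousPe _ _).1 cu e eI (eps / 8 / (`|a| + 1)).
  by rewrite !divr_gt0.
have M1 : 0 < M + 1 by have := M0; lra.
pose r3 := eps / 8 / (M + 1).
have r30 : 0 < r3 by rewrite !divr_gt0.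
exists (Num.min (Num.min r1 r2) r3); first by rewrite !lt_min r10 r20 r30.
move=> y yI; rewrite !lt_min => /andP[/andP[yr1 yr2] yr3].
have [->|ye] := eqVneq y e; first by rewrite subrr normr0.
have [z [zI ze zy E]] := MVT_point cu u_dx eI (in_open_closed yI) ye.
have ye0 : 0 < `|y - e| by rewrite normr_gt0 subr_eq0.
have p1 : `|v z - v e| <= eps / 4.
  have := H1 y (in_open_closed yI) yr1.
  by rewrite E -mulrBl normrM ler_pM2r.
have p2 := flux_lipschitz yI zI.
have p3 : M * `|y - z| <= eps / 8.
  rewrite distrC; apply: (@le_trans _ _ ((M + 1) * r3)).
    apply: ler_pM => //; first by rewrite lerDl.
    by apply: le_trans zy _; exact: ltW.
  by rewrite /r3 mulrC divfK// gt_eqF.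
have p4 : `|a| * `|u y - u z| <= eps / 4.
  have q1 := H2 y (in_open_closed yI) yr2.
  have q2 := H2 z (in_open_closed zI) (le_lt_trans ze yr2).
  have q3 : `|u y - u z| <= 2 * (eps / 8 / (`|a| + 1)).
    have -> : u y - u z = (u y - u e) - (u z - u e) by ring.
    by apply: le_trans (ler_normB _ _) _; lra.
  apply: (@le_trans _ _ ((`|a| + 1) * (2 * (eps / 8 / (`|a| + 1))))).
    by apply: ler_pM => //; rewrite lerDl.
  rewrite le_eqVlt; apply/orP; left; apply/eqP; field.
  by rewrite gt_eqF.
have -> : v y - v e = ((v y + a * u y) - (v z + a * u z)) - a * (u y - u z) + (v z - v e).
  by ring.
apply: le_lt_trans (ler_normD _ _) _.
have := ler_normB (v y + a * u y - (v z + a * u z)) (a * (u y - u z)).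
by rewrite normrM; lra.
Qed.

Lemma endpoint_or_open (x : R) : x \in `[- l, l] ->
  [\/ x = - l, x = l | x \in `]- l, l[].
Proof.
rewrite !in_itv/= !le_eqVlt => /andP[/orP[/eqP <- _|x1]]; first exact: Or31.
by move=> /orP[/eqP ->|x2]; [exact: Or32|apply: Or33; rewrite x1].
Qed.

Let u_within x : x \in `[- l, l] -> is_derive_within I u x (v x).
Proof.
move=> /endpoint_or_open[-> //|-> //|xI].
exact: is_derive_within_sub (u_dx xI).
Qed.

Lemma slope_cont : {within I, continuous v}.
Proof.
apply/within_continuousPe => x xI e e0.
have [r r0 Hr] := slope_cont_within xI (u_within xI) e0.
have l2 : 0 < 2 * l by rewrite mulr_gt0.
case: (endpoint_or_open xI) => [xE|xE|xo].
- exists (Num.min r (2 * l)); first by rewrite lt_min r0.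
  move=> y yI; rewrite lt_min xE => /andP[yr yl].
  case: (endpoint_or_open yI) => [->|yE|yo]; first by rewrite subrr normr0.
    by move: yl; rewrite yE opprK ger0_norm ?addr_ge0 ?ltW//; lra.
  by rewrite -xE; apply: Hr; rewrite ?xE.
- exists (Num.min r (2 * l)); first by rewrite lt_min r0.
  move=> y yI; rewrite lt_min xE => /andP[yr yl].
  case: (endpoint_or_open yI) => [yE|->|yo]; last first.
  + by rewrite -xE; apply: Hr; rewrite ?xE.
  + by rewrite subrr normr0.
  by move: yl; rewrite yE -opprD normrN ger0_norm ?addr_ge0 ?ltW//; lra.
have := is_derive_cont (v_dx xo) => /cvgrPdist_lt/(_ e e0)[r' /= r'0 H].
exists r' => // y _ yr; rewrite distrC; apply: H.
by rewrite /ball_/= distrC.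
Qed.

(** By the mean value theorem the difference quotients of [v] at an endpoint
    are values of the continuous function [- a * v x - f (u x)] nearby. *)
Lemma slope_derive_within x : x \in `[- l, l] ->
  is_derive_within I v x (- a * v x - f (u x)).
Proof.
move=> xI; apply/is_derive_withinP => e e0.
pose F x := - a * v x - f (u x).
have cF : {within I, continuous F}.
  have cfu : {within I, continuous (fun z => f (u z))}.
    by apply: (@within_continuous_comp _ _ _ _ u f) => [z _|]; [exact: cf|exact: cu].
  move=> z; apply: cvgB; last exact: cfu.
  by apply: cvgM; [exact: cvg_cst|exact: slope_cont].
have [r r0 Hr] := (within_continuousPe _ _).1 cF x xI e e0.
exists r => // y yI yr.
have [->|yx] := eqVneq y x; first by rewrite !subrr mulr0 subr0 normr0 mulr0.
have [z [zI ze _ E]] := MVT_point slope_cont v_dx xI yI yx.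
rewrite E -mulrBl normrM ler_wpM2r//; apply/ltW.
by apply: (Hr z (in_open_closed zI)); exact: le_lt_trans yr.
Qed.

End Endpoint.

(** The second derivative of the profile has the same limit at both endpoints,
    because the equation expresses it by the first derivative and [f (u x)]. *)
Lemma bvp_smooth (R : realType) (f : R -> R) (l : R) (j : nat) (a M : R)
    (u : R -> R) : 0 < l -> continuous f -> (forall x, `|f x| <= M) ->
  (forall x, f (x - 2 * pi * j%:R) = f x) ->
  bvp_solution f l j a u -> equal_end_slopes l u ->
  (forall x, u (x + 2 * l) = u x - 2 * pi * j%:R) ->
  exists du : R -> R, [/\ forall x, du (x + 2 * l) = du x,
    forall x, is_derive x (1 : R) u (du x) &
    forall x, is_derive x (1 : R) du (- a * du x - f (u x))].
Proof.
move=> l0 cf fM fper hu [d [dN dl]] us.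
pose s (x : R) : R := if x \in `]- l, l[ then (derive1 u) x else d.
have sN : s (- l) = d by rewrite /s in_itv/= ltxx.
have sl : s l = d by rewrite /s in_itv/= ltxx andbF.
have so (x : R) : x \in `]- l, l[ -> s x = (derive1 u) x by rewrite /s => ->.
have u_dx (x : R) : x \in `]- l, l[ -> is_derive x (1 : R) u (s x).
  move=> xI; rewrite so// derive1E; apply: derivableP.
  exact: (bvp_derivable hu).
have s_dx (x : R) : x \in `]- l, l[ -> is_derive x (1 : R) s (- a * s x - f (u x)).
  move=> xI; move: (xI); rewrite in_itv/= => /andP[x1 x2].
  apply: (@is_derive_eq_near _ (derive1 u) _ _ _ (Num.min (x + l) (l - x))).
  - by rewrite lt_min; apply/andP; split; lra.
  - move=> y; rewrite lt_min !ltr_norml => /andP[/andP[? ?] /andP[? ?]].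
    by rewrite so// in_itv/=; apply/andP; split; lra.
  - have -> : - a * s x - f (u x) = derive1 (derive1 u) x.
      by have := bvp_eq hu xI; rewrite so//; lra.
    rewrite [X in is_derive _ _ _ X]derive1E; apply: derivableP.
    exact: (bvp_derivable2 hu).
have cu := bvp_cont hu.
pose du : R -> R := unroll l 0 s.
have du_s (x : R) : x \in `[- l, l] -> du x = s x.
  by move=> xI; apply: unroll_id => //; rewrite sN sl addr0.
have dus (x : R) : du (x + 2 * l) = du x by rewrite /du unroll_shift// subr0.
have uN' : is_derive_within [set` `[- l, l]] u (- l) (s (- l)) by rewrite sN.
have ul' : is_derive_within [set` `[- l, l]] u l (s l) by rewrite sl.
exists du; split => //.
- apply: (glue_derive l0 us dus) => x xI; rewrite du_s//.
  case: (endpoint_or_open xI) => [->|->|xo] //.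
  exact: is_derive_within_sub (u_dx x xo).
- apply: (@glue_derive _ l 0 l0) => [x|x|x xI]; first by rewrite dus subr0.
    by rewrite dus us fper.
  apply: (@is_derive_within_eq _ _ s) => //; first by move=> y /du_s.
  rewrite du_s//.
  exact: (slope_derive_within l0 cf fM cu u_dx s_dx uN' ul').
Qed.

(** * Sign of the wave speed *)

Section WaveSpeed.
Context {R : realType} (f F : R -> R) (l c a D : R) (u du : R -> R).
Hypothesis F_dx : forall x, is_derive x (1 : R) F (f x).
Hypothesis Fc : forall x, F (x - c) = F x - D.
Hypothesis us : forall x, u (x + 2 * l) = u x - c.
Hypothesis dus : forall x, du (x + 2 * l) = du x.
Hypothesis u_dx : forall x, is_derive x (1 : R) u (du x).
Hypothesis du_dx : forall x, is_derive x (1 : R) du (- a * du x - f (u x)).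

(** The energy [u' ^+ 2 / 2 + F u] has derivative [- a * u' ^+ 2], yet it loses
    [D] over a period. *)
Lemma wave_speed_gt0 : 0 < l -> 0 < D -> 0 < a.
Proof.
move=> l0 D0; rewrite ltNge; apply/negP => a0.
pose E x := 1 / 2 * (du x * du x) + F (u x).
have E_dx x : is_derive x (1 : R) E (- a * (du x * du x)).
  apply: is_derive_val (is_derive_add (is_derive_mul (is_derive_const (1 / 2) x)
    (is_derive_mul (du_dx x) (du_dx x))) (is_derive_chain (F_dx (u x)) (u_dx x))) _.
  by field.
have cE : {within [set` `[0, 2 * l]], continuous E}.
  by apply: continuous_subspaceT; exact: is_derive_continuous E_dx.
have l2 : 0 <= 2 * l by lra.
have [z _] := MVT_segment l2 (fun z _ => E_dx z) cE.
have -> : E (2 * l) = E 0 - D.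
  by rewrite -[2 * l]add0r /E dus us Fc; ring.
have : 0 <= - a * (du z * du z) * (2 * l - 0).
  rewrite subr0; apply: mulr_ge0 => //; apply: mulr_ge0; first by lra.
  by rewrite -expr2 sqr_ge0.
lra.
Qed.

End WaveSpeed.

(** * Unrolling the solution *)

Section UnrolledFlow.
Context {R : realType} (f : R -> R) (l : R) (j : nat).
Context (th thx thxx tht : R -> R -> R).
Local Notation c := (2 * pi * j%:R).
Hypothesis l0 : 0 < l.
Hypothesis fper : forall (x : R) (k : int), f (x - c * k%:~R) = f x.
Hypothesis hth : phase_solution_with f l j th thx thxx tht.
Hypothesis th0 : th (- l) 0 = th l 0 + c.

Let v x t := unroll l c (th^~ t) x.
Let vx x t := unroll l 0 (thx^~ t) x.
Let vxx x t := unroll l 0 (thxx^~ t) x.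
Let vt x t := unroll l 0 (tht^~ t) x.

Let bc t : 0 <= t -> th (- l) t = th l t + c.
Proof. by rewrite le_eqVlt => /orP[/eqP <- //|]; exact: (phase_bc hth). Qed.

Let ltNl' : - l <= l. Proof. exact: ltNl. Qed.

Let lI : l \in `[- l, l]. Proof. by rewrite in_itv/= lexx ltNl'. Qed.
Let NlI : - l \in `[- l, l]. Proof. by rewrite in_itv/= lexx ltNl'. Qed.

(* The time derivative of the boundary condition matches [tht] at the two
   endpoints; through the equation this matches [thxx] there. *)
Let bct t : 0 < t -> tht (- l) t = tht l t.
Proof.
move=> t0.
have := is_derive_add (phase_dt hth lI t0) (is_derive_const c t).
rewrite addr0 => D; apply: is_derive_uniq (phase_dt hth NlI t0) _.
apply: (is_derive_eq_near t0) D => s; rewrite ltr_norml => /andP[s1 s2].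
by rewrite bc//; lra.
Qed.

Let bcxx t : 0 < t -> thxx (- l) t = thxx l t.
Proof.
move=> t0; have := phase_eq hth lI t0; have := phase_eq hth NlI t0.
rewrite bct// bc ?ltW//.
have := fper (th l t + c) 1; rewrite mulr1 addrK => <-; lra.
Qed.

Local Notation T := ([set` `[0, +oo[] : set R).

Let vE x t : 0 <= t -> x \in `[- l, l] -> v x t = th x t.
Proof. by move=> t0 xI; apply: unroll_id => //; exact: bc. Qed.

Let unroll0_shift g x : unroll l 0 g (x + 2 * l) = unroll l 0 g x.
Proof. by rewrite unroll_shift// subr0. Qed.

Let unroll0_id g x : g (- l) = g l -> x \in `[- l, l] -> unroll l 0 g x = g x.
Proof. by move=> gl; apply: unroll_id; rewrite ?addr0. Qed.

Let closed_slab (p q : R) : closed ([set` `[p, q]] `*` T).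
Proof.
have -> : [set` `[p, q]] `*` T =
    fst @^-1` [set` `[p, q]] `&` snd @^-1` T :> set (R * R) by [].
apply: closedI; apply: preimage_closed.
- by move=> z _; exact: cvg_fst.
- exact: itv_closed_ends_closed.
- by move=> z _; exact: cvg_snd.
- exact: itv_closed_ends_closed.
Qed.

Let unroll_cont : {within `[- l, 3 * l] `*` `[0, +oo[,
  continuous (fun z : R * R => v z.1 z.2)}.
Proof.
have -> : [set` `[- l, 3 * l]] `*` T =
    ([set` `[- l, l]] `*` T) `|` ([set` `[l, 3 * l]] `*` T).
  apply/seteqP; split=> -[x t] /=; rewrite !in_itv/=.
    by move=> [/andP[x1 x2] t0]; have [xl|lx] := leP x l; [left|right];
      split => //; apply/andP; split; lra.
  have := l0 => l0'.
  by case=> -[/andP[x1 x2] t0]; split => //; apply/andP; split; lra.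
apply: withinU_continuous; [exact: closed_slab|exact: closed_slab| |].
  apply: (@subspace_eq_continuous _ _ _ (fun z : R * R => th z.1 z.2)).
    move=> [x t] /set_mem[/= xI]; rewrite /= in_itv/= andbT => t0.
    by rewrite /from_subspace/= vE.
  exact: (phase_cont hth).
apply: (@subspace_eq_continuous _ _ _
    (fun z : R * R => th (z.1 - 2 * l) z.2 - c)).
  move=> [x t] /set_mem[/= xI]; rewrite /= in_itv/= andbT => t0.
  rewrite /from_subspace/= -vE//; first by rewrite /v -unroll_shift// subrK.
  by move: xI; rewrite !in_itv/= => /andP[? ?]; apply/andP; split; lra.
move=> z; apply: cvgB; last exact: cvg_cst.
apply: (@within_continuous_precomp _ _ _ _ _
  (fun z : R * R => (z.1 - 2 * l, z.2)) _ (phase_cont hth)).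
  apply: continuous_pair => {}z; last exact: cvg_snd.
  by apply: cvgB; [exact: cvg_fst|exact: cvg_cst].
move=> [x t] /= []; rewrite /= !in_itv/= => /andP[? ?] t0; split => //=.
by apply/andP; split; lra.
Qed.

Lemma unroll_flow : phase_flow f l c v vx vxx vt.
Proof.
split.
- by move=> x t _; rewrite /v unroll_shift.
- exact: unroll_cont.
- move=> x t t0; apply: (@glue_derive _ l c l0 (v^~ t) (vx^~ t)) => [y|y|y yI].
  + exact: unroll_shift.
  + exact: unroll0_shift.
  + rewrite /vx unroll0_id//; last exact: (phase_bcx hth).
    apply: (@is_derive_within_eq _ _ (th^~ t)) => //; last exact: (phase_dx hth).
    by move=> z zI; rewrite vE// ltW.
- move=> x t t0; apply: (@glue_derive _ l 0 l0 (vx^~ t) (vxx^~ t)) => [y|y|y yI].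
  + exact: unroll_shift.
  + exact: unroll0_shift.
  + rewrite /vxx unroll0_id//; last exact: bcxx.
    apply: (@is_derive_within_eq _ _ (thx^~ t)) => //; last exact: (phase_dxx hth).
    by move=> z zI; rewrite /vx unroll0_id//; exact: (phase_bcx hth).
- move=> x t t0; have [k kI E] := unroll_spec x l0.
  have -> : v x = (fun s => th (x - 2 * l * k%:~R) s - c * k%:~R).
    by apply/funext => s; rewrite /v E.
  rewrite /vt E mul0r.
  exact: is_derive_sub (phase_dt hth kI t0) (is_derive_const _ t).
- move=> x t t0; have [k kI E] := unroll_spec x l0.
  by rewrite /vt /vxx /v !E !mul0r !subr0 fper; exact: (phase_eq hth).
Qed.

End UnrolledFlow.

Lemma flow_phase_solution (R : realType) (f : R -> R) (l : R) (j : nat)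
    (v vx vxx vt : R -> R -> R) : 0 < l ->
  phase_flow f l (2 * pi * j%:R) v vx vxx vt ->
  (forall x t, vx (x + 2 * l) t = vx x t) ->
  continuous (fun z : R * R => v z.1 z.2) ->
  continuous (fun z : R * R => vx z.1 z.2) ->
  continuous (fun z : R * R => vxx z.1 z.2) ->
  continuous (fun z : R * R => vt z.1 z.2) ->
  phase_solution_with f l j v vx vxx vt.
Proof.
move=> l0 hv vxs c1 c2 c3 c4.
have lE : l = - l + 2 * l by ring.
split; try exact: continuous_subspaceT.
- by move=> x t _ t0; apply: is_derive_within_sub; exact: (flow_dx hv).
- by move=> x t _ t0; apply: is_derive_within_sub; exact: (flow_dxx hv).
- by move=> x t _ t0; exact: (flow_dt hv).
- by move=> x t _ t0; exact: (flow_eq hv).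
- by move=> t t0; rewrite {2}lE (flow_shift hv) ?subrK// ltW.
- by move=> t t0; rewrite [in RHS]lE vxs.
Qed.

(** * The nonlinearity *)

Lemma cos_lipschitz (R : realType) (x y : R) : `|cos x - cos y| <= `|x - y|.
Proof.
wlog xy : x y / y <= x.
  move=> H; have [/H //|/ltW/H] := leP y x.
  by rewrite distrC (distrC y).
have [| c _ ->] := @MVT_segment R cos (fun z => - sin z) y x xy.
  by apply: continuous_subspaceT => z; exact: continuous_cos.
rewrite normrM normrN ler_piMl//.
by rewrite ler_norml sin_geN1 sin_le1.
Qed.

Section PhaseNonlinearity.
Context {R : realType} (Theta0 f0 : R).
Local Notation f := (phase_f Theta0 f0).

Lemma phase_f_lipschitz x y : `|f x - f y| <= `|x - y|.
Proof.
have := cos_lipschitz (x + Theta0) (y + Theta0).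
have -> : x + Theta0 - (y + Theta0) = x - y by ring.
rewrite (_ : _ - _ = f x - f y) // /phase_f; ring.
Qed.

Lemma phase_f_continuous : continuous f.
Proof.
move=> x; apply: cvgD; last exact: cvg_cst.
apply: (@continuous_comp _ _ _ (fun v => v + Theta0) cos).
  by apply: cvgD; [exact: cvg_id|exact: cvg_cst].
exact: continuous_cos.
Qed.

Lemma phase_f_bounded x : `|f x| <= 1 + `|f0|.
Proof.
apply: le_trans (ler_normD _ _) _; rewrite lerD2r ler_norml.
by rewrite cos_geN1 cos_le1.
Qed.

Lemma phase_f_period (j : nat) x (k : int) : f (x - 2 * pi * j%:R * k%:~R) = f x.
Proof.
have fp y : f (y + 2 * pi) = f y - 0.
  by rewrite subr0 /phase_f addrAC mulr_natl cosD2pi.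
have := shift_int fp x (- (j%:Z * k)).
rewrite mul0r subr0 => <-; congr f.
by rewrite intrN intrM mulrN mulrA.
Qed.

Definition phase_potential (v : R) : R := sin (v + Theta0) + f0 * v.

Lemma phase_potential_derive x : is_derive x (1 : R) phase_potential (f x).
Proof.
have D : is_derive x (1 : R) (fun v => v + Theta0) (1 + 0).
  exact: is_derive_add (is_derive_idfun x) (is_derive_const Theta0 x).
apply: is_derive_val (is_derive_add (is_derive_chain (is_derive_sin _) D)
  (is_derive_mul (is_derive_const f0 x) (is_derive_idfun x))) _.
by rewrite /phase_f; ring.
Qed.

Lemma phase_potential_shift (j : nat) x :
  phase_potential (x - 2 * pi * j%:R) = phase_potential x - f0 * (2 * pi * j%:R).
Proof.
have sp y : sin (y + 2 * pi) = sin y - 0 :> R by rewrite subr0 mulr_natl sinD2pi.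
have := shift_int sp (x + Theta0) (- j%:Z).
rewrite /phase_potential mul0r subr0 intrN mulrN => E.
by rewrite addrAC -E; ring.
Qed.

End PhaseNonlinearity.

(** * The circle and uniform convergence *)

Section Circle.
Context {R : realType}.

(** A number that is not an integer keeps a positive distance to all integers. *)
Lemma circle_ball_hausdorff (z w : circle R) :
  (forall e, 0 < e -> circle_ball z e w) -> z = w.
Proof.
rewrite -[z]reprK -[w]reprK; set p := repr z; set q := repr w => H.
apply/to_circleP.
have pi2 : 0 < 2 * pi :> R by rewrite mulr_gt0 ?pi_gt0.
pose r := (p - q) / (2 * pi).
have rE : p - q = 2 * pi * r by rewrite /r mulrC divfK// gt_eqF.
pose k := Num.floor r; have /andP[k1 k2] := floor_itv r.
rewrite -/k in k1 k2.
have [kr|kr] := eqVneq k%:~R r; first by exists k; rewrite rE kr.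
have {kr}k1 : k%:~R < r by rewrite lt_neqAle kr.
pose e := 2 * pi * Num.min (r - k%:~R) ((k + 1)%:~R - r).
have e0 : 0 < e by rewrite mulr_gt0// lt_min !subr_gt0 k1.
have [x [y [xp yq xy]]] := H e e0.
have /to_circleP[m1 Em1] : to_circle x = to_circle p by [].
have /to_circleP[m2 Em2] : to_circle y = to_circle q by [].
pose n := m2 - m1.
have : `|r - n%:~R| < Num.min (r - k%:~R) ((k + 1)%:~R - r).
  rewrite -(ltr_pM2l pi2) -/e; apply: le_lt_trans xy.
  rewrite -[X in X * _](gtr0_norm pi2) -normrM mulrBr -rE /n intrB mulrBr -Em1 -Em2.
  by rewrite le_eqVlt; apply/orP; left; apply/eqP; congr (`| _ |); ring.
rewrite lt_min => /andP[n1 n2].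
have [nk|kn] := leP n k.
  have : n%:~R <= k%:~R :> R by rewrite ler_int.
  by move: n1; rewrite ltr_norml => /andP[]; lra.
have : (k + 1)%:~R <= n%:~R :> R by rewrite ler_int addrC lez1D.
by move: n2; rewrite ltr_norml => /andP[]; lra.
Qed.

Lemma circle_ball_lt (x y e : R) :
  `|x - y| < e -> circle_ball (to_circle x) e (to_circle y).
Proof. by move=> xy; exists x, y. Qed.

Lemma near_uniform (A : set R) (v : R -> circle R) (e : R) : 0 < e ->
  nbhs (v : {uniform` A -> circle R})
    [set h : {uniform` A -> circle R} | forall x, A x -> circle_ball (v x) e (h x)].
Proof.
move=> e0; apply/uniform_nbhs; exists [set p | circle_ball p.1 e p.2]; split => //.
by rewrite -entourage_ballE; exists e.
Qed.

Lemma uniform_ball (A : set R) (v : R -> circle R) P :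
  nbhs (v : {uniform` A -> circle R}) P ->
  exists2 e : R, 0 < e & forall h : R -> circle R,
    (forall x, A x -> circle_ball (v x) e (h x)) -> P h.
Proof.
move=> /uniform_nbhs[E [+ EP]]; rewrite -entourage_ballE => -[e /= e0 eE].
by exists e => // h vh; apply: EP => x Ax; apply: eE; exact: vh.
Qed.

End Circle.

(** * The omega-limit set *)

Section OmegaLimit.
Context {R : realType} (l a L s0 : R) (j : nat) (th : R -> R -> R) (u : R -> R).
Local Notation c := (2 * pi * j%:R).
Hypothesis l0 : 0 < l.
Hypothesis a0 : 0 < a.
Hypothesis L0 : 0 < L.
Hypothesis us : forall x, u (x + 2 * l) = u x - c.
Hypothesis uL : forall x y, `|u x - u y| <= L * `|x - y|.
Hypothesis conv : forall e, 0 < e -> exists T, forall x t, x \in `[- l, l] ->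
  T <= t -> `|th x t - u (x - a * t - s0)| <= e.

Let u_circle x (k : int) : to_circle (u (x + 2 * l * k%:~R)) = to_circle (u x).
Proof.
apply/to_circleP; exists (- (j%:Z * k)).
by rewrite (shift_int us) intrN intrM; ring.
Qed.

(* The solution follows [u (x - a * t - s0)], and [a * t] runs through all phases
   again and again because [0 < a]. *)
Let orbit_sub_omega :
  wave_orbit l (fun x t => u (x - a * t)) `<=` omega_limit l th.
Proof.
move=> v [t1 vE] A B [M [_ MA]] /uniform_ball[e e0 eB].
have [|T HT] := conv (e := e / 2); first by rewrite divr_gt0.
have l2 : 0 < 2 * l by rewrite mulr_gt0.
(* A time beyond [M] and [T] at which the shifted wave is in phase with [v]. *)
pose n := (Num.truncn ((a * (`|M| + `|T| + `|t1| + 1) + `|s0|) / (2 * l))).+1.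
pose t := t1 + (2 * l * n%:R - s0) / a.
have tb : `|M| + `|T| + 1 <= t.
  have n_gt : (a * (`|M| + `|T| + `|t1| + 1) + `|s0|) / (2 * l) < n%:R.
    exact: truncnS_gt.
  move: n_gt; rewrite ltr_pdivrMr// => n_gt.
  have : `|M| + `|T| + `|t1| + 1 <= (2 * l * n%:R - s0) / a.
    by rewrite ler_pdivlMr//; have := ler_norm s0; lra.
  have := ler_norm (- t1); rewrite normrN /t; lra.
have [Mt Tt] : M < t /\ T <= t.
  have := ler_norm M; have := ler_norm T.
  by have := normr_ge0 M; have := normr_ge0 T; split; lra.
exists (fun x => to_circle (th x t)); split; first exact: MA.
apply: eB => x xI.
have -> : v x = to_circle (u (x - a * t - s0)).
  rewrite vE// -(u_circle (x - a * t - s0) n); congr (to_circle (u _)).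
  by rewrite /t; field; rewrite gt_eqF.
apply: circle_ball_lt; rewrite distrC.
by apply: le_lt_trans (HT x t xI Tt) _; lra.
Qed.

Let omega_near_wave v : omega_limit l th v -> forall e, 0 < e ->
  exists2 s, s \in `[0, 2 * l] &
    forall x, x \in `[- l, l] -> circle_ball (v x) e (to_circle (u (x - s))).
Proof.
move=> vo e e0.
have [|T HT] := conv (e := e / 4); first by rewrite divr_gt0.
have e2 : 0 < e / 2 by rewrite divr_gt0.
have FA : \forall t \near +oo, exists2 t', T <= t' &
    (fun x => to_circle (th x t)) = (fun x => to_circle (th x t')).
  by exists T; split; [exact: num_real|move=> t /ltW tT; exists t].
have [h [[t Tt hE] hB]] := vo
  [set h | exists2 t, T <= t & h = (fun x => to_circle (th x t))] _
  FA (near_uniform [set` `[- l, l]] v e2).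
have [k kI] := fundamental_domain (a * t + s0 - l) l0.
have l0' := l0; move: kI; rewrite in_itv/= => /andP[k1 k2].
exists (a * t + s0 - 2 * l * k%:~R).
  by rewrite in_itv/=; apply/andP; split; lra.
move=> x xI.
have -> : x - (a * t + s0 - 2 * l * k%:~R) = x - a * t - s0 + 2 * l * k%:~R by ring.
rewrite u_circle; have -> : e = e / 2 + e / 2 by field.
apply: circle_ball_triangle (hB x xI) _; rewrite hE; apply: circle_ball_lt.
by apply: le_lt_trans (HT x t xI Tt) _; lra.
Qed.

(* The phases of the approximating waves, reduced to a period, accumulate. *)
Let omega_sub_orbit :
  omega_limit l th `<=` wave_orbit l (fun x t => u (x - a * t)).
Proof.
move=> v vo.
have inv_gt0 (n : nat) : 0 < n.+1%:R^-1 :> R by rewrite invr_gt0.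
have /choice[s Hs] : forall n : nat, exists s, s \in `[0, 2 * l] /\
    forall x, x \in `[- l, l] -> circle_ball (v x) n.+1%:R^-1 (to_circle (u (x - s))).
  by move=> n; have [s sI H] := omega_near_wave vo (inv_gt0 n); exists s.
have [|p [_ pcl]] := @segment_compact R 0 (2 * l) (s @ \oo) _.
  by exists 0%N => // n _; exact: (Hs n).1.
exists (p / a) => x xI.
have -> : x - a * (p / a) = x - p by field; rewrite gt_eqF.
apply: circle_ball_hausdorff => e e0.
have e2L : 0 < e / 2 / L by rewrite !divr_gt0.
pose N := Num.truncn (2 / e).
have NA : (s @ \oo) [set q | exists2 n, (N <= n)%N & q = s n].
  by exists N => // n /= Nn; exists n.
have [q [[n Nn ->]]] := pcl _ _ NA (nbhsx_ballx p _ e2L).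
rewrite /ball/= => pq.
have -> : e = e / 2 + e / 2 by field.
apply: (@circle_ball_triangle _ _ (to_circle (u (x - s n)))).
  have [y [z [yv zu yz]]] := (Hs n).2 x xI.
  exists y, z; split => //; apply: lt_trans yz _.
  rewrite invf_plt ?posrE ?divr_gt0// invf_div.
  apply: lt_le_trans (truncnS_gt _) _.
  by rewrite ler_nat.
apply: circle_ball_lt; apply: le_lt_trans (uL _ _) _.
have -> : x - s n - (x - p) = p - s n by ring.
by rewrite mulrC -ltr_pdivlMr.
Qed.

Lemma omega_limit_wave :
  omega_limit l th = wave_orbit l (fun x t => u (x - a * t)).
Proof. by apply/seteqP; split. Qed.

End OmegaLimit.

Theorem proposition28 (R : realType) (f0 Theta0 l : R) (j : nat)
    (th0 : R -> R) (th : R -> R -> R) (a : R) (u : R -> R)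
    (hf0 : 0 < f0 < 1)
    (hTheta0 : 0 < Theta0 < pi)
    (hf : phase_f Theta0 f0 0 = 0)
    (hl : 0 < l)
    (hj : (0 < j)%N)
    (hth0_cont : {within `[- l, l], continuous th0})
    (hth0_range : forall x : R, x \in `[- l, l] -> 0 <= th0 x <= 2 * pi * j%:R)
    (hth0_right : th0 l = 0)
    (hth0_left : th0 (- l) = 2 * pi * j%:R)
    (hth : phase_solution (phase_f Theta0 f0) l j th)
    (hth_init : forall x : R, x \in `[- l, l] -> th x 0 = th0 x)
    (hu : bvp_solution (phase_f Theta0 f0) l j a u)
    (ha : equal_end_slopes l u)
    (hu_ext : forall x : R, u (x + 2 * l) = u x - 2 * pi * j%:R) :
  let U := fun x t : R => u (x - a * t) in
  [/\ phase_solution (phase_f Theta0 f0) l j U,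
      (exists2 T : R, 0 < T &
        forall x t : R, to_circle (U x (t + T)) = to_circle (U x t)) &
      omega_limit l th = wave_orbit l U].
Proof.
move=> U; set f := phase_f Theta0 f0.
have c0 : 0 < 2 * pi * j%:R :> R by rewrite !mulr_gt0 ?pi_gt0 ?ltr0n.
have fL : forall x y, `|f x - f y| <= `|x - y| := phase_f_lipschitz Theta0 f0.
have fper x (k : int) : f (x - 2 * pi * j%:R * k%:~R) = f x by exact: phase_f_period.
have fper1 x : f (x - 2 * pi * j%:R) = f x by have := fper x 1; rewrite mulr1.
have cf : continuous f by exact: phase_f_continuous.
have [du [dus u_dx du_dx]] :=
  bvp_smooth hl cf (phase_f_bounded Theta0 f0) fper1 hu ha hu_ext.
have D0 : 0 < f0 * (2 * pi * j%:R) by case/andP: hf0 => f00 _; rewrite mulr_gt0.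
have a0 : 0 < a := wave_speed_gt0 (phase_potential_derive Theta0 f0)
  (phase_potential_shift Theta0 f0 j) hu_ext dus u_dx du_dx hl D0.
have lI : l \in `[- l, l] by rewrite in_itv/= lexx ltNl.
have NlI : - l \in `[- l, l] by rewrite in_itv/= lexx ltNl.
split.
- have cu := is_derive_continuous u_dx; have cdu := is_derive_continuous du_dx.
  have cU (g : R -> R) : continuous g ->
      continuous (fun z : R * R => g (z.1 - a * z.2)).
    move=> cg z; apply: (@continuous_comp _ _ _ (fun z : R * R => z.1 - a * z.2) g).
      apply: cvgB; first exact: cvg_fst.
      by apply: cvgM; [exact: cvg_cst|exact: cvg_snd].
    exact: cg.
  exists (fun x t => du (x - a * t)),
    (fun x t => - a * du (x - a * t) - f (u (x - a * t))),
    (fun x t => - a * du (x - a * t)).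
  have E (g : R -> R) : (fun x t => g (x - a * t - 0)) = (fun x t => g (x - a * t)).
    by apply/funext => x; apply/funext => t; rewrite subr0.
  have hU := wave_flow hu_ext u_dx du_dx 0.
  rewrite (E u) (E du) (E (fun z => - a * du z)) (E (fun z => - a * du z - f (u z))) in hU.
  apply: flow_phase_solution => //.
  + by move=> x t; rewrite addrAC dus.
  + exact: cU.
  + exact: cU.
  + apply: (cU (fun z => - a * du z - f (u z))) => z; apply: cvgB.
      by apply: cvgM; [exact: cvg_cst|exact: cdu].
    by apply: (@continuous_comp _ _ _ u f); [exact: cu|exact: cf].
  + apply: (cU (fun z => - a * du z)) => z.
    by apply: cvgM; [exact: cvg_cst|exact: cdu].
- exists (2 * l / a); first by rewrite divr_gt0// mulr_gt0.
  move=> x t; apply/to_circleP; exists j%:Z; rewrite /U.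
  have -> : x - a * t = x - a * (t + 2 * l / a) + 2 * l by field; rewrite gt_eqF.
  by rewrite hu_ext opprB addrCA subrr addr0.
have [thx [thxx [tht hth']]] := hth.
have th0E : th (- l) 0 = th l 0 + 2 * pi * j%:R.
  by rewrite !hth_init// hth0_left hth0_right add0r.
have hv := unroll_flow hl fper hth' th0E.
have [s0 conv] := flow_converges fL hl c0 hu_ext dus u_dx du_dx hv.
have [L L0 uL] := wave_lipschitz hl dus u_dx du_dx.
apply: (omega_limit_wave hl a0 L0 hu_ext uL (s0 := s0)) => e e0.
have [T T0 HT] := conv e e0; exists T => x t xI Tt.
have <- : unroll l (2 * pi * j%:R) (th^~ t) x = th x t; last exact: HT.
have t0 : 0 <= t by exact: le_trans Tt.
apply: unroll_id => //; move: t0; rewrite le_eqVlt => /orP[/eqP <- //|t0].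
exact: (phase_bc hth').
Qed.
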